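(* Let $A>0$. Among all real-valued potentials $V\in L^1[0,1]$ with $\|V\|_{L^1}\le A$, the quantity $\det\mathscr{T}_V$ attains its maximum at exactly one potential (up to equality a.e.), namely the symmetric pulse \[ V_A=\frac{A}{\ell(A)}\,\chi_{[\frac12-\frac{\ell(A)}2,\ \frac12+\frac{\ell(A)}2]},\qquad \ell(A)=\frac{A}{(1+\sqrt{1+A})^2}. \] The maximum value is \[ \max_{\|V\|_1\le A}\det\mathscr{T}_V=\frac{4}{1+\sqrt{1+A}}\exp\!\Big(\frac{A}{1+\sqrt{1+A}}\Big). \]
   Context: For a real-valued potential $V\in L^q[0,1]$ ($q\ge1$), let $y_V$ be the solution of $-y''+Vy=0$ on $[0,1]$ with $y(0)=0$, $y'(0)=1$. Let $\mathscr{T}_V$ be the Schrödinger operator $\phi\mapsto-\phi''+V\phi$ on $[0,1]$ with Dirichlet conditions $\phi(0)=\phi(1)=0$. Its functional determinant is $\det\mathscr{T}_V=2y_V(1)$. For non-negative $V$ this coincides with the zeta-regularized determinant $e^{-\zeta'_{\mathscr{T}_V}(0)}$, where $\zeta_{\mathscr{T}_V}(s)=\sum_n\lambda_n^{-s}$ over the Dirichlet eigenvalues $\lambda_n$, meromorphically continued. For general $V$, $2y_V(1)$ is the continuous extension of this determinant. $\chi_I$ denotes the indicator function of the interval $I$. *)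

(* Defs.v *)
From Stdlib Require Import Reals Lra List.
Import ListNotations.
Open Scope R_scope.

Inductive tagged_div : R -> R -> list ((R * R) * R) -> Prop :=
| td_nil : forall a, tagged_div a a []
| td_cons : forall a t b c l,
    a < b -> a <= t <= b -> tagged_div b c l ->
    tagged_div a c (((a, t), b) :: l).

Definition delta_fine (delta : R -> R) (l : list ((R * R) * R)) : Prop :=
  Forall (fun p => snd (fst p) - delta (snd (fst p)) < fst (fst p) /\
                   snd p < snd (fst p) + delta (snd (fst p))) l.

Definition riemann_sum (f : R -> R) (l : list ((R * R) * R)) : R :=
  fold_right (fun p s => f (snd (fst p)) * (snd p - fst (fst p)) + s) 0 l.

Definition HK_integral (f : R -> R) (a b I : R) : Prop :=
  forall eps, 0 < eps ->
    exists delta : R -> R, (forall x, 0 < delta x) /\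
      forall l, tagged_div a b l -> delta_fine delta l ->
        Rabs (riemann_sum f l - I) < eps.

(* Lebesgue integrability on [0,1] = absolute HK integrability;
   the L^1 norm is the integral of |V|. *)
Definition L1_norm_le (V : R -> R) (A : R) : Prop :=
  (exists I, HK_integral V 0 1 I) /\
  (exists J, HK_integral (fun x => Rabs (V x)) 0 1 J /\ J <= A).

Definition cont_on_01 (y : R -> R) : Prop :=
  forall x, 0 <= x <= 1 -> forall eps, 0 < eps -> exists d, 0 < d /\
    forall z, 0 <= z <= 1 -> Rabs (z - x) < d -> Rabs (y z - y x) < eps.

(* y is the (Carathéodory) solution of -y'' + V y = 0, y(0)=0, y'(0)=1 on [0,1],
   in its equivalent integral-equation form. *)
Definition is_yV (V y : R -> R) : Prop :=
  cont_on_01 y /\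
  forall x, 0 <= x <= 1 ->
    HK_integral (fun t => (x - t) * V t * y t) 0 x (y x - x).

(* functional determinant det T_V = 2 y_V(1) *)
Definition det_T (y : R -> R) : R := 2 * y 1.

Definition null_set (N : R -> Prop) : Prop :=
  forall eps, 0 < eps -> exists a b : nat -> R,
    (forall n, a n <= b n) /\
    (forall x, N x -> exists n, a n < x < b n) /\
    (forall n, sum_f_R0 (fun k => b k - a k) n <= eps).

Definition ae_eq_01 (V W : R -> R) : Prop :=
  null_set (fun x => 0 <= x <= 1 /\ V x <> W x).

Definition ell (A : R) : R := A / (1 + sqrt (1 + A)) ^ 2.

Definition indicator (lo hi : R) (x : R) : R :=
  if Rle_dec lo x then (if Rle_dec x hi then 1 else 0) else 0.

Definition pulse (A : R) (x : R) : R :=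
  A / ell A * indicator (1/2 - ell A / 2) (1/2 + ell A / 2) x.

Definition max_value (A : R) : R :=
  4 / (1 + sqrt (1 + A)) * exp (A / (1 + sqrt (1 + A))).

(* Main.v *)
(* Write k = 1 + sqrt (1 + A), let y_A be the solution for the pulse, p_A its slope, and
   g = y_A z_A / y_A(1) the diagonal of the extremal Green function, so that g' = 2 g p_A/y_A - 1
   and g <= 1/(2k), with equality exactly on the pulse.

   Given V with solution y, the function Y(x) = x + int_0^x (x - t) |V| |y| dt dominates |y|
   and solves Y'' = W Y with 0 <= W <= |V|. With P = Y' and F = int |V|, the function
     g P / Y + ln (Y / y_A) + k x / 2 - F / (2k)
   has derivative at most - g (P/Y - p_A/y_A)^2 on (0, 1], in the sense of increments: the
   only irregular terms are g dP / Y <= g dF and dF / (2k). Its limit at 0 is at most 1, and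
   its value at 1 is at least ln (Y(1) / y_A(1)) + 1, whence Y(1) <= y_A(1). In the case of
   equality P/Y = p_A/y_A, so Y = y_A; then y = Y, and int_c^d (|V| - V_A) y_A = 0 for all c <= d
   forces V = V_A almost everywhere by the Saks-Henstock lemma. *)

From Coquelicot Require Import Coquelicot.
From Stdlib Require Import Reals Lra Lia List Classical ClassicalEpsilon.
Require Import Defs.
Import ListNotations.
Open Scope R_scope.

(** The functional comes from optimal control. The logarithmic derivative u = P/Y satisfies u' = W -
    u^2, and ln Y(1) is, up to the singularity at 0, the integral of u, to be maximized under a
    bound on the integral of W. The relation g' = 2 g u_A - 1 with g(1) = 0 is the adjoint equation,
    1/(2k) is the multiplier of the budget, and k/2, the coefficient of x, is the constant value of
    the Hamiltonian: g u_A^2 - u_A + k/2 = 0. Completing the square leaves - g (u - u_A)^2 and the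
    term g W - |V|/(2k) <= 0. The obstacle is regularity: V is only integrable, so P and F need not
    have derivatives at every point. Increments of the functional are therefore estimated on small
    intervals around each tag, with the slope frozen, and chained along a fine division. The facts
    on integrals (products with continuous functions, continuity of primitives, vanishing almost
    everywhere) are drawn from gauges in the same local-to-global manner. *)

(** * Tagged divisions, Riemann sums and Cousin's lemma *)

Lemma tagged_div_le a b l : tagged_div a b l -> a <= b.
Proof. induction 1; lra. Qed.

Lemma tagged_div_app a b c l1 l2 :
  tagged_div a b l1 -> tagged_div b c l2 -> tagged_div a c (l1 ++ l2).
Proof.
  intros H1 H2; induction H1; simpl; auto.
  constructor; auto.
Qed.

Lemma tagged_div_single a t b :
  a < b -> a <= t <= b -> tagged_div a b [((a, t), b)].
Proof. intros; repeat (constructor; auto). Qed.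

Lemma riemann_sum_app f l1 l2 :
  riemann_sum f (l1 ++ l2) = riemann_sum f l1 + riemann_sum f l2.
Proof. induction l1 as [|p l1 IH]; simpl; [ring|rewrite IH; ring]. Qed.

Lemma riemann_sum_lin f g u v l :
  riemann_sum (fun x => u * f x + v * g x) l
  = u * riemann_sum f l + v * riemann_sum g l.
Proof. induction l as [|p l IH]; simpl; [ring|rewrite IH; ring]. Qed.

Lemma riemann_sum_le f g a b l :
  tagged_div a b l -> (forall x, a <= x <= b -> f x <= g x) ->
  riemann_sum f l <= riemann_sum g l.
Proof.
  induction 1 as [a|a t b c l Hab Ht Hl IH]; intros Hfg; simpl; [lra|].
  assert (Hbc := tagged_div_le _ _ _ Hl).
  apply Rplus_le_compat.
  - apply Rmult_le_compat_r; [lra|apply Hfg; lra].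
  - apply IH; intros; apply Hfg; lra.
Qed.

Lemma riemann_sum_ext f g a b l :
  tagged_div a b l -> (forall x, a <= x <= b -> f x = g x) ->
  riemann_sum f l = riemann_sum g l.
Proof.
  intros Hl H; apply Rle_antisym; apply (riemann_sum_le _ _ a b); auto;
    intros x Hx; rewrite (H x Hx); lra.
Qed.

Lemma riemann_sum_const u a b l :
  tagged_div a b l -> riemann_sum (fun _ => u) l = u * (b - a).
Proof. induction 1; simpl; [ring|rewrite IHtagged_div; ring]. Qed.

Lemma delta_fine_app d l1 l2 :
  delta_fine d l1 -> delta_fine d l2 -> delta_fine d (l1 ++ l2).
Proof. intros; apply Forall_app; auto. Qed.

Lemma delta_fine_weaken (d d' : R -> R) l :
  (forall x, d x <= d' x) -> delta_fine d l -> delta_fine d' l.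
Proof.
  intros H; apply Forall_impl; intros [[a t] b]; simpl.
  specialize (H t); lra.
Qed.

Lemma delta_fine_single (d : R -> R) a t b :
  t - d t < a -> b < t + d t -> delta_fine d [((a, t), b)].
Proof. intros; constructor; simpl; auto. Qed.

Definition gauge (d : R -> R) : Prop := forall x, 0 < d x.

Definition fine_div (d : R -> R) a b l : Prop :=
  tagged_div a b l /\ delta_fine d l.

Lemma fine_div_app d a b c l1 l2 :
  fine_div d a b l1 -> fine_div d b c l2 -> fine_div d a c (l1 ++ l2).
Proof.
  intros [? ?] [? ?]; split; [eapply tagged_div_app|apply delta_fine_app]; eauto.
Qed.

Lemma fine_div_single (d : R -> R) a t b :
  a < b -> a <= t <= b -> t - d t < a -> b < t + d t ->
  fine_div d a b [((a, t), b)].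
Proof. split; [apply tagged_div_single|apply delta_fine_single]; auto. Qed.

Lemma gauge_min d1 d2 : gauge d1 -> gauge d2 -> gauge (fun x => Rmin (d1 x) (d2 x)).
Proof. intros H1 H2 x; apply Rmin_pos; auto. Qed.

Lemma fine_div_min d1 d2 a b l :
  fine_div (fun x => Rmin (d1 x) (d2 x)) a b l ->
  fine_div d1 a b l /\ fine_div d2 a b l.
Proof.
  intros [H1 H2]; repeat split; auto;
    (eapply delta_fine_weaken; [|exact H2]); intros x; simpl;
    [apply Rmin_l|apply Rmin_r].
Qed.

(** Compactness in gauge form: a fine division ending just below the supremum [m] of the reachable
    end points extends across [m] by one interval tagged at [m]. *)
Lemma cousin d a b : gauge d -> a <= b -> exists l, fine_div d a b l.
Proof.
  intros Hd Hab.
  set (E := fun x => a <= x <= b /\ exists l, fine_div d a x l).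
  destruct (completeness E) as [m [Hub Hlub]].
  { exists b; intros x [Hx _]; lra. }
  { exists a; split; [lra|]; exists nil; split; constructor. }
  assert (Ham : a <= m).
  { apply Hub; split; [lra|]; exists nil; split; constructor. }
  assert (Hmb : m <= b) by (apply Hlub; intros x [Hx _]; lra).
  assert (Hx : exists x, E x /\ m - d m < x).
  { apply NNPP; intros Hn.
    assert (is_upper_bound E (m - d m)).
    { intros x Ex; apply Rnot_lt_le; intros Hlt; apply Hn; exists x; auto. }
    specialize (Hlub _ H); specialize (Hd m); lra. }
  destruct Hx as [x [[Hx [l Hl]] Hxm]].
  assert (Hxlem : x <= m) by (apply Hub; split; eauto).
  specialize (Hd m).
  assert (Hz : forall z, m <= z <= b -> z < m + d m -> E z).
  { intros z Hz1 Hz2; split; [lra|].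
    destruct (Req_dec x z) as [<-|Hne]; [eauto|].
    exists (l ++ [((x, m), z)]); eapply fine_div_app; eauto.
    apply fine_div_single; lra. }
  destruct (Req_dec m b) as [Hmb'|Hne].
  { rewrite <- Hmb'; destruct (Hz m) as [_ H]; auto; lra. }
  exfalso.
  set (z := Rmin b (m + d m / 2)).
  assert (z <= b /\ z <= m + d m / 2 /\ m < z).
  { unfold z; repeat split; [apply Rmin_l|apply Rmin_r|apply Rmin_glb_lt; lra]. }
  assert (z <= m) by (apply Hub; apply Hz; lra).
  lra.
Qed.

(** Local-to-global principle, obtained by chaining along a Cousin division. It is applied to
    approximate integrability of a product and to the slow growth of [calib]. *)
Lemma cousin_rel (Rel : R -> R -> Prop) a b :
  a <= b -> (forall c, Rel c c) ->
  (forall c d e, a <= c -> c <= d -> d <= e -> e <= b ->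
     Rel c d -> Rel d e -> Rel c e) ->
  (forall t, a <= t <= b -> exists r, 0 < r /\ forall c d,
     a <= c -> c <= t -> t <= d -> d <= b -> c < d -> t - r < c -> d < t + r ->
     Rel c d) ->
  Rel a b.
Proof.
  intros Hab Hrefl Htrans Hloc.
  (* A gauge is a function on all of R, hence the default radius 1 off [a, b]. *)
  assert (Hg : forall t, exists r, 0 < r /\ (a <= t <= b -> forall c d,
     a <= c -> c <= t -> t <= d -> d <= b -> c < d -> t - r < c -> d < t + r ->
     Rel c d)).
  { intros t; destruct (classic (a <= t <= b)) as [Ht|Ht].
    - destruct (Hloc t Ht) as [r [Hr H]]; exists r; split; auto.
    - exists 1; split; [lra|tauto]. }
  destruct (choice _ Hg) as [d Hd].
  destruct (cousin d a b) as [l [Hl1 Hl2]]; auto.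
  { intros x; apply Hd. }
  assert (Hgen : forall c e l, tagged_div c e l -> delta_fine d l ->
             a <= c -> e <= b -> Rel c e).
  { clear l Hl1 Hl2; intros c e l Hl; induction Hl as [|c t c' e l Hc Ht Hl IH]; auto.
    intros Hf Ha Hb; inversion Hf as [|? ? Hp Hf']; subst; simpl in Hp.
    assert (Hle := tagged_div_le _ _ _ Hl).
    apply (Htrans c c' e); try lra.
    - apply (proj2 (Hd t)); lra.
    - apply IH; auto; lra. }
  apply (Hgen a b l); auto; lra.
Qed.

(** * The Henstock-Kurzweil integral *)

(** A fixed tolerance with a non-strict bound: tolerances add along adjacent intervals, and a
    degenerate interval has tolerance 0. *)
Definition HK_within (f : R -> R) (a b I r : R) : Prop :=
  exists d, gauge d /\
    forall l, fine_div d a b l -> Rabs (riemann_sum f l - I) <= r.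

Lemma HK_within_of_integral f a b I r :
  HK_integral f a b I -> 0 < r -> HK_within f a b I r.
Proof.
  intros H Hr; destruct (H r Hr) as [d [Hd Hl]]; exists d; split; auto.
  intros l [H1 H2]; left; auto.
Qed.

Lemma HK_integral_of_within f a b I :
  (forall r, 0 < r -> HK_within f a b I r) -> HK_integral f a b I.
Proof.
  intros H r Hr; destruct (H (r / 2)) as [d [Hd Hl]]; [lra|].
  exists d; split; auto; intros l H1 H2.
  specialize (Hl l (conj H1 H2)); lra.
Qed.

Lemma HK_within_weaken f a b I r r' :
  r <= r' -> HK_within f a b I r -> HK_within f a b I r'.
Proof.
  intros Hr [d [Hd H]]; exists d; split; auto.
  intros l Hl; specialize (H l Hl); lra.
Qed.

(** The two conditions on [d] force any interval that straddles [c] to be tagged at [c]; cutting it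
    there yields two admissible intervals with the same tag and the same total contribution. *)
Lemma fine_div_split f d c a b l :
  fine_div d a b l -> a <= c <= b ->
  (forall x, x < c -> d x <= c - x) -> (forall x, c < x -> d x <= x - c) ->
  exists l1 l2, fine_div d a c l1 /\ fine_div d c b l2 /\
    riemann_sum f l = riemann_sum f l1 + riemann_sum f l2.
Proof.
  intros [Hl Hf] Hc Hd1 Hd2; revert Hf Hc.
  induction Hl as [a|a t b e l Hab Ht Hl IH]; intros Hf Hc.
  { exists nil, nil; replace c with a by lra.
    repeat split; try constructor; simpl; ring. }
  inversion Hf as [|? ? Hp Hf']; subst; simpl in Hp.
  destruct (Req_dec a c) as [<-|Hac].
  { exists nil, (((a, t), b) :: l); repeat split; auto; try constructor; auto.
    simpl; ring. }
  destruct (Rle_dec b c) as [Hbc|Hbc].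
  { destruct IH as [l1 [l2 [[H1 H1'] [H2 H3]]]]; auto; [lra|].
    exists (((a, t), b) :: l1), l2; repeat split; try constructor; auto; try apply H2.
    simpl; rewrite H3; ring. }
  assert (t = c).
  { destruct (Rtotal_order t c) as [Htc|[Htc|Htc]]; auto; exfalso.
    - specialize (Hd1 t Htc); lra.
    - specialize (Hd2 t Htc); lra. }
  subst t.
  exists [((a, c), c)], (((c, c), b) :: l); repeat split; try constructor; auto;
    simpl; try lra; try constructor.
Qed.

Lemma HK_within_chasles f a c b I1 I2 r1 r2 :
  a <= c <= b -> HK_within f a c I1 r1 -> HK_within f c b I2 r2 ->
  HK_within f a b (I1 + I2) (r1 + r2).
Proof.
  intros Hc [d1 [Hd1 H1]] [d2 [Hd2 H2]].
  set (e := fun x => if Req_EM_T x c then 1 else Rabs (x - c)).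
  assert (He : gauge e).
  { intros x; unfold e; destruct (Req_EM_T x c); [lra|].
    apply Rabs_pos_lt; lra. }
  exists (fun x => Rmin (Rmin (d1 x) (d2 x)) (e x)); split.
  { apply gauge_min; auto; apply gauge_min; auto. }
  intros l Hl.
  assert (Hx : forall x, x <> c -> Rmin (Rmin (d1 x) (d2 x)) (e x) <= Rabs (x - c)).
  { intros x Hx; eapply Rle_trans; [apply Rmin_r|].
    unfold e; destruct (Req_EM_T x c); [tauto|lra]. }
  destruct (fine_div_split f _ c _ _ _ Hl Hc) as [l1 [l2 [Hl1 [Hl2 ->]]]].
  { intros x Hxc; eapply Rle_trans; [apply Hx; lra|]; rewrite Rabs_left; lra. }
  { intros x Hxc; eapply Rle_trans; [apply Hx; lra|]; rewrite Rabs_right; lra. }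
  apply fine_div_min, proj1, fine_div_min, proj1 in Hl1.
  apply fine_div_min, proj1, fine_div_min, proj2 in Hl2.
  specialize (H1 _ Hl1); specialize (H2 _ Hl2).
  revert H1 H2; unfold Rabs; repeat destruct Rcase_abs; lra.
Qed.

Lemma HK_chasles f a c b I J :
  a <= c <= b -> HK_integral f a c I -> HK_integral f c b J ->
  HK_integral f a b (I + J).
Proof.
  intros Hc H1 H2; apply HK_integral_of_within; intros r Hr.
  replace r with (r / 2 + r / 2) by field.
  apply (HK_within_chasles f a c b); auto; apply HK_within_of_integral; auto; lra.
Qed.

Lemma HK_within_dist f g a b I J r r' :
  a <= b -> HK_within f a b I r -> HK_within g a b J r' ->
  exists l, tagged_div a b l /\ Rabs (riemann_sum f l - I) <= r /\
    Rabs (riemann_sum g l - J) <= r'.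
Proof.
  intros Hab [d1 [Hd1 H1]] [d2 [Hd2 H2]].
  destruct (cousin _ a b (gauge_min _ _ Hd1 Hd2) Hab) as [l Hl].
  apply fine_div_min in Hl; destruct Hl as [Hl1 Hl2].
  exists l; split; [apply Hl1|]; auto.
Qed.

Lemma HK_le f g a b I J :
  a <= b -> HK_integral f a b I -> HK_integral g a b J ->
  (forall x, a <= x <= b -> f x <= g x) -> I <= J.
Proof.
  intros Hab HI HJ Hfg; apply Rnot_lt_le; intros Hlt.
  destruct (HK_within_dist f g a b I J ((I - J) / 3) ((I - J) / 3))
    as [l [Hl [H1 H2]]]; auto;
    try (apply HK_within_of_integral; auto; lra).
  assert (H := riemann_sum_le f g a b l Hl Hfg).
  revert H1 H2; unfold Rabs; repeat destruct Rcase_abs; lra.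
Qed.

Lemma HK_unique f a b I J :
  a <= b -> HK_integral f a b I -> HK_integral f a b J -> I = J.
Proof.
  intros Hab HI HJ; apply Rle_antisym; eapply HK_le; eauto; intros; lra.
Qed.

Lemma HK_lin f g a b I J u v :
  HK_integral f a b I -> HK_integral g a b J ->
  HK_integral (fun x => u * f x + v * g x) a b (u * I + v * J).
Proof.
  intros HI HJ; apply HK_integral_of_within; intros r Hr.
  assert (Hu := Rabs_pos u); assert (Hv := Rabs_pos v).
  set (e := r / (Rabs u + Rabs v + 1)).
  assert (He : 0 < e) by (apply Rdiv_lt_0_compat; lra).
  destruct (HK_within_of_integral _ _ _ _ e HI He) as [d1 [Hd1 H1]].
  destruct (HK_within_of_integral _ _ _ _ e HJ He) as [d2 [Hd2 H2]].
  exists (fun x => Rmin (d1 x) (d2 x)); split; [apply gauge_min; auto|].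
  intros l Hl; apply fine_div_min in Hl; destruct Hl as [Hl1 Hl2].
  specialize (H1 _ Hl1); specialize (H2 _ Hl2).
  rewrite riemann_sum_lin.
  replace (_ - _) with (u * (riemann_sum f l - I) + v * (riemann_sum g l - J)) by ring.
  eapply Rle_trans; [apply Rabs_triang|]; rewrite !Rabs_mult.
  assert (Hr' : r = (Rabs u + Rabs v + 1) * e) by (unfold e; field; lra).
  rewrite Hr'; nra.
Qed.

Lemma HK_nonneg f a b I :
  a <= b -> HK_integral f a b I -> (forall x, a <= x <= b -> 0 <= f x) -> 0 <= I.
Proof.
  intros Hab HI Hf.
  replace 0 with (0 * I + 0 * I) by ring.
  apply (HK_le (fun x => 0 * f x + 0 * f x) f a b); auto; [apply HK_lin; auto|].
  intros x Hx; specialize (Hf x Hx); lra.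
Qed.

Lemma HK_ext f g a b I :
  (forall x, a <= x <= b -> f x = g x) -> HK_integral f a b I -> HK_integral g a b I.
Proof.
  intros Hfg HI e He; destruct (HI e He) as [d [Hd H]]; exists d; split; auto.
  intros l Hl Hf; rewrite <- (riemann_sum_ext f g a b); auto.
Qed.

Lemma HK_point f a : HK_integral f a a 0.
Proof.
  intros e He; exists (fun _ => 1); split; [intros; lra|].
  intros l Hl _; inversion Hl; subst; simpl.
  - rewrite Rminus_0_r, Rabs_R0; auto.
  - apply tagged_div_le in H1; lra.
Qed.

(** Cauchy criterion. By Cousin's lemma any two approximations share a division, so their error
    intervals meet; the integral is the supremum of the lower ends J - r. *)
Lemma HK_complete f a b :
  a <= b -> (forall r, 0 < r -> exists I, HK_within f a b I r) ->
  exists I, HK_integral f a b I.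
Proof.
  intros Hab H.
  set (E := fun x => exists J r, 0 < r /\ HK_within f a b J r /\ x = J - r).
  assert (Hle : forall J r J' r', HK_within f a b J r -> HK_within f a b J' r' ->
             J - r <= J' + r').
  { intros J r J' r' H1 H2.
    destruct (HK_within_dist f f a b J J' r r') as [l [_ [H3 H4]]]; auto.
    revert H3 H4; unfold Rabs; repeat destruct Rcase_abs; lra. }
  destruct (completeness E) as [I [Hub Hlub]].
  { destruct (H 1) as [J HJ]; [lra|]; exists (J + 1).
    intros x [J' [r' [Hr' [H' ->]]]]; eauto. }
  { destruct (H 1) as [J HJ]; [lra|]; exists (J - 1), J, 1; repeat split; auto; lra. }
  exists I; apply HK_integral_of_within; intros r Hr.
  destruct (H (r / 2)) as [J HJ]; [lra|].
  assert (J - r / 2 <= I) by (apply Hub; exists J, (r / 2); repeat split; auto; lra).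
  assert (I <= J + r / 2).
  { apply Hlub; intros x [J' [r' [Hr' [H' ->]]]]; eauto. }
  destruct HJ as [d [Hd HJ]]; exists d; split; auto; intros l Hl.
  specialize (HJ l Hl).
  revert HJ; unfold Rabs; repeat destruct Rcase_abs; lra.
Qed.

(** Fixed divisions of the two outer pieces complete any two fine divisions of [c, e] to fine
    divisions of [a, b], so the Riemann sums over [c, e] differ by at most r. *)
Lemma HK_subinterval f a b c e I :
  a <= c -> c <= e -> e <= b -> HK_integral f a b I ->
  exists J, HK_integral f c e J.
Proof.
  intros Hac Hce Heb HI; apply HK_complete; auto; intros r Hr.
  destruct (HK_within_of_integral _ _ _ _ (r / 2) HI) as [d [Hd H]]; [lra|].
  destruct (cousin d a c Hd Hac) as [l1 Hl1].
  destruct (cousin d e b Hd Heb) as [l3 Hl3].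
  destruct (cousin d c e Hd Hce) as [l2 Hl2].
  exists (riemann_sum f l2), d; split; auto; intros l Hl.
  assert (H1 := H _ (fine_div_app _ _ _ _ _ _ Hl1 (fine_div_app _ _ _ _ _ _ Hl Hl3))).
  assert (H2 := H _ (fine_div_app _ _ _ _ _ _ Hl1 (fine_div_app _ _ _ _ _ _ Hl2 Hl3))).
  rewrite !riemann_sum_app in H1, H2.
  revert H1 H2; unfold Rabs; repeat destruct Rcase_abs; lra.
Qed.

Definition primitive_on (f : R -> R) (a b : R) (F : R -> R) : Prop :=
  forall c e, a <= c -> c <= e -> e <= b -> HK_integral f c e (F e - F c).

Lemma HK_primitive f a b I :
  a <= b -> HK_integral f a b I -> exists F, F a = 0 /\ primitive_on f a b F.
Proof.
  intros Hab HI.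
  assert (Hx : forall x, exists J, a <= x <= b -> HK_integral f a x J).
  { intros x; destruct (classic (a <= x <= b)) as [Hx|Hx].
    - destruct (HK_subinterval f a b a x I) as [J HJ]; try lra; eauto.
    - exists 0; tauto. }
  destruct (choice _ Hx) as [F HF]; exists F; split.
  - apply (HK_unique f a a); [lra|apply HF; lra|apply HK_point].
  - intros c e Hc Hce He.
    destruct (HK_subinterval f a b c e I) as [J HJ]; auto.
    replace (F e - F c) with J; auto.
    assert (F e = F c + J); [|lra].
    apply (HK_unique f a e); [lra|apply HF; lra|].
    apply (HK_chasles f a c e); auto; apply HF; lra.
Qed.

(** * The Saks-Henstock lemma *)

Definition increment_sum (h : R -> R -> R -> R) (l : list ((R * R) * R)) : R :=
  fold_right (fun p s => h (fst (fst p)) (snd (fst p)) (snd p) + s) 0 l.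

(* Keep the selected intervals, and redivide each of the others so finely that its
   Riemann sum is close to the increment of the primitive. *)
Lemma saks_henstock_select f a b F d (sel : R -> R -> R -> Prop) e c c' l :
  primitive_on f a b F -> gauge d -> 0 < e ->
  fine_div d c c' l -> a <= c -> c' <= b ->
  exists l', fine_div d c c' l' /\
    Rabs (riemann_sum f l' - (F c' - F c) -
      increment_sum (fun x t y => if excluded_middle_informative (sel x t y)
                         then f t * (y - x) - (F y - F x) else 0) l) <= e.
Proof.
  intros HF Hd He [Hl Hf]; revert e He Hf.
  induction Hl as [c|c t m c' l Hc Ht Hl IH]; intros e He Hf Ha Hb.
  { exists nil; split; [split; constructor|]; simpl.
    unfold Rminus; rewrite Rplus_opp_r, !Ropp_0, !Rplus_0_r, Rabs_R0; lra. }
  inversion Hf as [|? ? Hp Hf']; subst; simpl in Hp.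
  assert (Hm := tagged_div_le _ _ _ Hl).
  destruct (IH (e / 2)) as [l' [Hl' HS]]; auto; try lra.
  simpl; destruct (excluded_middle_informative (sel c t m)).
  - exists ([((c, t), m)] ++ l'); split.
    { eapply fine_div_app; eauto; apply fine_div_single; lra. }
    simpl; revert HS; unfold Rabs; repeat destruct Rcase_abs; lra.
  - assert (HI : HK_integral f c m (F m - F c)) by (apply HF; lra).
    destruct (HI (e / 2)) as [d' [Hd' H]]; [lra|].
    destruct (cousin _ c m (gauge_min _ _ Hd Hd')) as [l0 Hl0]; [lra|].
    apply fine_div_min in Hl0; destruct Hl0 as [Hl0 [H0 H0']].
    exists (l0 ++ l'); split; [eapply fine_div_app; eauto|].
    specialize (H l0 H0 H0'); rewrite riemann_sum_app.
    revert HS H; unfold Rabs; repeat destruct Rcase_abs; lra.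
Qed.

(** Selecting the intervals of nonnegative error and those of negative error separately turns a
    bound on signed totals into one on absolute values. Each selection costs e / 4 for the integral
    and e / 4 for the redivision. *)
Lemma saks_henstock f a b F e :
  a <= b -> primitive_on f a b F -> 0 < e ->
  exists d, gauge d /\ forall l, fine_div d a b l ->
    increment_sum (fun x t y => Rabs (f t * (y - x) - (F y - F x))) l <= e.
Proof.
  intros Hab HF He.
  assert (HI : HK_integral f a b (F b - F a)) by (apply HF; lra).
  destruct (HK_within_of_integral _ _ _ _ (e / 4) HI) as [d [Hd H]]; [lra|].
  exists d; split; auto; intros l Hl.
  set (p := fun x t y => 0 <= f t * (y - x) - (F y - F x)).
  set (n := fun x t y => ~ p x t y).
  destruct (saks_henstock_select f a b F d p (e / 4) a b l) as [l1 [Hl1 H1]];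
    auto; try lra.
  destruct (saks_henstock_select f a b F d n (e / 4) a b l) as [l2 [Hl2 H2]];
    auto; try lra.
  apply H in Hl1; apply H in Hl2.
  set (s1 := increment_sum _ l) in H1; set (s2 := increment_sum _ l) in H2.
  replace (increment_sum _ l) with (s1 - s2).
  { revert Hl1 Hl2 H1 H2; unfold Rabs; repeat destruct Rcase_abs; lra. }
  unfold s1, s2; clear - n; induction l as [|[[x t] y] l IH]; simpl; [ring|].
  rewrite <- IH.
  destruct (excluded_middle_informative (p x t y)) as [Hp|Hp];
  destruct (excluded_middle_informative (n x t y)) as [Hn|Hn];
    try (exfalso; unfold n in Hn; tauto); unfold p in Hp.
  - rewrite Rabs_right; lra.
  - rewrite Rabs_left; lra.
Qed.

(** Continuity of the primitive at [t]: isolate one interval tagged at [t] in the Saks-Henstock sum.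
    The radius also keeps [f t * (c' - c)] below e / 2. *)
Lemma primitive_local f a b F t e :
  primitive_on f a b F -> a <= t <= b -> 0 < e ->
  exists r, 0 < r /\ forall c c', a <= c -> c <= t -> t <= c' -> c' <= b ->
    t - r < c -> c' < t + r -> Rabs (F c' - F c) <= e.
Proof.
  intros HF Ht He.
  destruct (saks_henstock f a b F (e / 2)) as [d [Hd H]]; auto; try lra.
  assert (Hpos := Rabs_pos (f t)).
  exists (Rmin (d t) (e / (4 * (Rabs (f t) + 1)))); split.
  { apply Rmin_pos; [apply Hd|apply Rdiv_lt_0_compat; lra]. }
  intros c c' H1 H2 H3 H4 H5 H6.
  assert (Hm1 := Rmin_l (d t) (e / (4 * (Rabs (f t) + 1)))).
  assert (Hm2 := Rmin_r (d t) (e / (4 * (Rabs (f t) + 1)))).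
  destruct (Req_dec c c') as [<-|Hne].
  { unfold Rminus; rewrite Rplus_opp_r, Rabs_R0; lra. }
  destruct (cousin d a c) as [l1 Hl1]; auto.
  destruct (cousin d c' b) as [l3 Hl3]; auto.
  assert (Hl2 : fine_div d c c' [((c, t), c')]) by (apply fine_div_single; lra).
  specialize (H _ (fine_div_app _ _ _ _ _ _ Hl1 (fine_div_app _ _ _ _ _ _ Hl2 Hl3))).
  assert (Hnn : forall l, 0 <= increment_sum
            (fun x t y => Rabs (f t * (y - x) - (F y - F x))) l).
  { induction l as [|p l IH]; simpl; [lra|].
    assert (Hq := Rabs_pos (f (snd (fst p)) * (snd p - fst (fst p)) -
                           (F (snd p) - F (fst (fst p))))); lra. }
  assert (Happ : forall l l', increment_sum
            (fun x t y => Rabs (f t * (y - x) - (F y - F x))) (l ++ l') =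
            increment_sum (fun x t y => Rabs (f t * (y - x) - (F y - F x))) l +
            increment_sum (fun x t y => Rabs (f t * (y - x) - (F y - F x))) l').
  { induction l as [|p l IH]; intros; simpl; [ring|rewrite IH; ring]. }
  rewrite !Happ in H; assert (N1 := Hnn l1); assert (N3 := Hnn l3); simpl in H.
  assert (Hft : Rabs (f t * (c' - c)) <= e / 2).
  { rewrite Rabs_mult, (Rabs_right (c' - c)) by lra.
    assert (c' - c <= 2 * (e / (4 * (Rabs (f t) + 1)))) by lra.
    apply Rle_trans with ((Rabs (f t) + 1) * (2 * (e / (4 * (Rabs (f t) + 1))))).
    - apply Rmult_le_compat; lra.
    - right; field; lra. }
  replace (F c' - F c) with (f t * (c' - c) - (f t * (c' - c) - (F c' - F c))) by ring.
  eapply Rle_trans; [apply Rabs_triang|]; rewrite Rabs_Ropp; lra.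
Qed.

(** * Products with continuous functions and the fundamental theorem of calculus *)

Definition continuous_within (h : R -> R) (a b : R) : Prop :=
  forall x, a <= x <= b -> forall e, 0 < e -> exists r, 0 < r /\
    forall z, a <= z <= b -> Rabs (z - x) < r -> Rabs (h z - h x) < e.

Lemma riemann_sum_abs f g a b l :
  tagged_div a b l -> (forall x, a <= x <= b -> Rabs (f x) <= g x) ->
  Rabs (riemann_sum f l) <= riemann_sum g l.
Proof.
  intros Hl H; apply Rabs_le; split.
  - replace (- riemann_sum g l) with (riemann_sum (fun x => (-1) * g x + 0 * g x) l).
    + apply (riemann_sum_le _ _ a b); auto; intros x Hx; specialize (H x Hx).
      apply Rabs_le_between in H; lra.
    + rewrite riemann_sum_lin; ring.
  - apply (riemann_sum_le _ _ a b); auto; intros x Hx; specialize (H x Hx).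
    apply Rabs_le_between in H; lra.
Qed.

(* Near [t] the product is [h t * f] up to [e * f]; chaining along a Cousin division
   gives approximate integrals of arbitrary precision. *)
Lemma HK_mult_continuous f h a b I :
  a <= b -> HK_integral f a b I -> (forall x, a <= x <= b -> 0 <= f x) ->
  continuous_within h a b -> exists J, HK_integral (fun x => f x * h x) a b J.
Proof.
  intros Hab HI Hf Hh; apply HK_complete; auto; intros r Hr.
  destruct (HK_primitive f a b I Hab HI) as [F [_ HF]].
  assert (Hmono : forall c e, a <= c -> c <= e -> e <= b -> F c <= F e).
  { intros c e H1 H2 H3.
    assert (0 <= F e - F c); [|lra].
    apply (HK_nonneg f c e); auto; intros x Hx; apply Hf; lra. }
  set (eta := r / (F b - F a + (b - a) + 1)).
  assert (HFab := Hmono a b ltac:(lra) Hab ltac:(lra)).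
  assert (Heta : 0 < eta) by (apply Rdiv_lt_0_compat; lra).
  assert (Hrel : exists J, HK_within (fun x => f x * h x) a b J
            (eta * (F b - F a) + eta * (b - a))).
  { apply (cousin_rel (fun c e => exists J, HK_within (fun x => f x * h x) c e J
            (eta * (F e - F c) + eta * (e - c))) a b); auto.
    - intros c; exists 0.
      replace (eta * (F c - F c) + eta * (c - c)) with 0 by ring.
      exists (fun _ => 1); split; [intros x; lra|].
      intros l [Hl _]; inversion Hl as [|? ? ? ? ? ? ? Hl']; subst; simpl.
      + rewrite Rminus_0_r, Rabs_R0; lra.
      + apply tagged_div_le in Hl'; lra.
    - intros c m e H1 H2 H3 H4 [J1 HJ1] [J2 HJ2]; exists (J1 + J2).
      replace (eta * (F e - F c) + eta * (e - c)) with
        ((eta * (F m - F c) + eta * (m - c)) + (eta * (F e - F m) + eta * (e - m)))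
        by ring.
      apply (HK_within_chasles _ c m e); auto.
    - intros t Ht.
      destruct (Hh t Ht eta Heta) as [s [Hs Hcont]].
      exists s; split; auto.
      intros c e H1 H2 H3 H4 H5 H6 H7.
      exists (h t * (F e - F c)).
      assert (Hht := Rabs_pos (h t)).
      (* Two errors must fit: freezing [h] costs eta times a sum that is at most F e - F c + k, and
         the error of that sum is multiplied by |h t|. Hence the denominator eta + |h t|. *)
      set (k := eta * (e - c) / (eta + Rabs (h t))).
      assert (Hk : 0 < k).
      { apply Rdiv_lt_0_compat; [apply Rmult_lt_0_compat|]; lra. }
      destruct (HK_within_of_integral f c e (F e - F c) k (HF c e H1 ltac:(lra) H4) Hk)
        as [d [Hd Hd']].
      exists d; split; auto; intros l Hl.
      specialize (Hd' l Hl); destruct Hl as [Hl _].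
      assert (Hd1 : Rabs (riemann_sum (fun x => f x * h x) l - h t * riemann_sum f l)
                <= eta * riemann_sum f l).
      { replace (_ - _) with (riemann_sum (fun x => 1 * (f x * h x) + (- h t) * f x) l)
          by (rewrite riemann_sum_lin; ring).
        replace (eta * riemann_sum f l) with
          (riemann_sum (fun x => eta * f x + 0 * f x) l)
          by (rewrite riemann_sum_lin; ring).
        apply (riemann_sum_abs _ _ c e); auto; intros x Hx.
        replace (1 * (f x * h x) + - h t * f x) with (f x * (h x - h t)) by ring.
        assert (Hfx : 0 <= f x) by (apply Hf; lra).
        rewrite Rabs_mult, (Rabs_right (f x)) by lra.
        assert (Rabs (h x - h t) < eta).
        { apply Hcont; [lra|]; apply Rabs_def1; lra. }
        nra. }
      replace (_ - _) with
        ((riemann_sum (fun x => f x * h x) l - h t * riemann_sum f l) +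
         h t * (riemann_sum f l - (F e - F c))) by ring.
      eapply Rle_trans; [apply Rabs_triang|].
      rewrite Rabs_mult.
      assert (Hsum : riemann_sum f l <= F e - F c + k).
      { apply Rabs_le_between in Hd'; lra. }
      assert (Hkk : (eta + Rabs (h t)) * k = eta * (e - c)) by (unfold k; field; lra).
      nra. }
  destruct Hrel as [J HJ]; exists J; eapply HK_within_weaken; [|exact HJ].
  assert (r = (F b - F a + (b - a) + 1) * eta) by (unfold eta; field; lra).
  nra.
Qed.

(** Since [t] lies between [c] and [d], the errors e (t - c) and e (d - t) add up to e (d - c). *)
Lemma is_derive_straddle W t l e :
  is_derive W t l -> 0 < e -> exists r, 0 < r /\ forall c d,
    c <= t -> t <= d -> t - r < c -> d < t + r ->
    Rabs (W d - W c - l * (d - c)) <= e * (d - c).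
Proof.
  intros HW He; apply is_derive_Reals in HW; destruct (HW e He) as [r Hr].
  assert (Hz : forall z, Rabs (z - t) < r ->
            Rabs (W z - W t - l * (z - t)) <= e * Rabs (z - t)).
  { intros z Hz; destruct (Req_dec z t) as [->|Hne].
    { rewrite !Rminus_diag, Rmult_0_r, Rminus_diag, Rabs_R0; lra. }
    assert (Hh : z - t <> 0) by lra.
    specialize (Hr _ Hh Hz); replace (t + (z - t)) with z in Hr by ring.
    replace (W z - W t - l * (z - t)) with (((W z - W t) / (z - t) - l) * (z - t))
      by (field; auto).
    rewrite Rabs_mult; apply Rmult_le_compat_r; [apply Rabs_pos|lra]. }
  exists r; split; [apply cond_pos|]; intros c d H1 H2 H3 H4.
  assert (Hc := Hz c ltac:(apply Rabs_def1; lra)).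
  assert (Hd := Hz d ltac:(apply Rabs_def1; lra)).
  rewrite (Rabs_right (d - t)) in Hd by lra.
  rewrite (Rabs_left1 (c - t)) in Hc by lra.
  apply Rabs_le_between in Hc; apply Rabs_le_between in Hd; apply Rabs_le; lra.
Qed.

(** Local errors are charged to the increments of [M], which telescope along a division. A
    discontinuous [M] can pay for exceptional tags by its jumps. *)
Lemma HK_of_local_increments f W M a b r :
  (forall t, a <= t <= b -> exists s, 0 < s /\ forall c d,
     c <= t -> t <= d -> c < d -> t - s < c -> d < t + s ->
     Rabs (W d - W c - f t * (d - c)) <= M d - M c) ->
  M b - M a <= r -> HK_within f a b (W b - W a) r.
Proof.
  intros Hloc HM.
  assert (Hg : forall t, exists s, 0 < s /\ (a <= t <= b -> forall c d,
     c <= t -> t <= d -> c < d -> t - s < c -> d < t + s ->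
     Rabs (W d - W c - f t * (d - c)) <= M d - M c)).
  { intros t; destruct (classic (a <= t <= b)) as [Ht|Ht].
    - destruct (Hloc t Ht) as [s [Hs H]]; exists s; auto.
    - exists 1; split; [lra|tauto]. }
  destruct (choice _ Hg) as [d Hd].
  exists d; split; [intros x; apply Hd|].
  assert (Hgen : forall c e l, tagged_div c e l -> delta_fine d l ->
     a <= c -> e <= b -> Rabs (riemann_sum f l - (W e - W c)) <= M e - M c).
  { intros c e l Hl; induction Hl as [c|c t m e l Hc Ht Hl IH]; intros Hf Ha Hb.
    { simpl; rewrite !Rminus_diag, Rabs_R0; lra. }
    inversion Hf as [|? ? Hp Hf']; subst; simpl in Hp.
    assert (Hle := tagged_div_le _ _ _ Hl).
    assert (H1 := IH Hf' ltac:(lra) Hb).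
    assert (H2 : Rabs (W m - W c - f t * (m - c)) <= M m - M c)
      by (apply (proj2 (Hd t)); lra).
    simpl; apply Rabs_le_between in H1; apply Rabs_le_between in H2.
    apply Rabs_le; lra. }
  intros l [Hl Hf].
  eapply Rle_trans; [apply (Hgen a b l)|]; auto; lra.
Qed.

(* The jumps of [sign] pay for the two exceptional tags. *)
Lemma HK_FTC_except2 W f a b e1 e2 :
  a <= b ->
  (forall t, a <= t <= b -> t <> e1 -> t <> e2 -> is_derive W t (f t)) ->
  (forall t, t = e1 \/ t = e2 -> continuous W t) ->
  HK_integral f a b (W b - W a).
Proof.
  intros Hab HW Hc; apply HK_integral_of_within; intros r Hr.
  (* Each [sign] varies by at most 2, so [M] below grows by at most e (b - a + 4). *)
  set (e := r / (b - a + 5)).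
  assert (He : 0 < e) by (apply Rdiv_lt_0_compat; lra).
  assert (Hre : r = e * (b - a + 5)) by (unfold e; field; lra).
  set (M := fun x => e * (x + sign (x - e1) + sign (x - e2))).
  assert (Hs : forall x, -1 <= sign x <= 1).
  { intros x; destruct (Rtotal_order x 0) as [H|[->|H]];
      [rewrite sign_eq_m1|rewrite sign_0|rewrite sign_eq_1]; lra. }
  assert (Hexc : forall t, t = e1 \/ t = e2 -> forall c d, c <= t -> t <= d -> c < d ->
            e <= M d - M c).
  (* An interval that has the exceptional point only as an end point still sees half of the jump. *)
  { assert (Hjump : forall t c d, c <= t -> t <= d -> c < d ->
              sign (c - t) + 1 <= sign (d - t)).
    { intros t c d H1 H2 H3.
      destruct (Rle_lt_or_eq_dec _ _ H1) as [H1'|<-].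
      - rewrite (sign_eq_m1 (c - t)) by lra.
        destruct (Rle_lt_or_eq_dec _ _ H2) as [H2'|<-].
        + rewrite sign_eq_1; lra.
        + rewrite Rminus_diag, sign_0; lra.
      - rewrite Rminus_diag, sign_0, sign_eq_1; lra. }
    intros t Ht c d H1 H2 H3; unfold M.
    assert (Hm1 := sign_le (c - e1) (d - e1) ltac:(lra)).
    assert (Hm2 := sign_le (c - e2) (d - e2) ltac:(lra)).
    assert (Hj := Hjump t c d H1 H2 H3).
    destruct Ht as [->| ->]; nra. }
  apply (HK_of_local_increments f W M).
  2:{ unfold M; assert (H1 := Hs (b - e1)); assert (H2 := Hs (b - e2)).
      assert (H3 := Hs (a - e1)); assert (H4 := Hs (a - e2)).
      rewrite Hre; nra. }
  intros t Ht; destruct (classic (t = e1 \/ t = e2)) as [Hex|Hex].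
  - assert (Hct := Hc t Hex).
    apply continuity_pt_filterlim in Hct.
    destruct (Hct (e / 4)) as [s [Hs0 Hs1]]; [lra|].
    assert (Hft := Rabs_pos (f t)).
    exists (Rmin s (e / (4 * (Rabs (f t) + 1)))); split.
    { apply Rmin_pos; [auto|apply Rdiv_lt_0_compat; lra]. }
    intros c d H1 H2 H3 H4 H5.
    assert (Hm1 := Rmin_l s (e / (4 * (Rabs (f t) + 1)))).
    assert (Hm2 := Rmin_r s (e / (4 * (Rabs (f t) + 1)))).
    assert (Hz : forall z, t - s < z -> z < t + s -> Rabs (W z - W t) <= e / 4).
    { intros z Hz1 Hz2; destruct (Req_dec z t) as [->|Hne].
      - rewrite Rminus_diag, Rabs_R0; lra.
      - left; apply Hs1; split.
        + split; [exact I|auto].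
        + simpl; unfold R_dist; apply Rabs_def1; lra. }
    assert (Hzc := Hz c ltac:(lra) ltac:(lra)).
    assert (Hzd := Hz d ltac:(lra) ltac:(lra)).
    assert (Hfd : Rabs (f t * (d - c)) <= e / 2).
    { rewrite Rabs_mult, (Rabs_right (d - c)) by lra.
      apply Rle_trans with ((Rabs (f t) + 1) * (2 * (e / (4 * (Rabs (f t) + 1))))).
      - apply Rmult_le_compat; lra.
      - right; field; lra. }
    eapply Rle_trans; [|apply (Hexc t Hex c d); auto].
    apply Rabs_le_between in Hzc; apply Rabs_le_between in Hzd.
    apply Rabs_le_between in Hfd; apply Rabs_le; lra.
  - destruct (is_derive_straddle W t (f t) e) as [s [Hs0 Hs1]]; auto.
    exists s; split; auto; intros c d H1 H2 H3 H4 H5.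
    eapply Rle_trans; [apply Hs1; auto|].
    unfold M.
    assert (Hm1 := sign_le (c - e1) (d - e1) ltac:(lra)).
    assert (Hm2 := sign_le (c - e2) (d - e2) ltac:(lra)).
    nra.
Qed.

(** * Null sets *)

Definition charf (E : R -> Prop) (x : R) : R :=
  if excluded_middle_informative (E x) then 1 else 0.

Lemma charf_bounds E x : 0 <= charf E x <= 1.
Proof. unfold charf; destruct excluded_middle_informative; lra. Qed.

Lemma riemann_sum_nonneg f a b l :
  tagged_div a b l -> (forall x, a <= x <= b -> 0 <= f x) -> 0 <= riemann_sum f l.
Proof.
  intros Hl H; rewrite <- (Rmult_0_l (b - a)), <- (riemann_sum_const 0 a b l Hl).
  apply (riemann_sum_le _ _ a b); auto.
Qed.

(** On level m the characteristic function is at most (m + 1) |f|. The division [l'] keeps the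
    intervals tagged on that level and redivides the others, which only add nonnegative terms to the
    right side. *)
Lemma support_level_sum f (lev : R -> nat) (d d' : R -> R) m a b l :
  (forall x, f x <> 0 -> 1 <= (INR (lev x) + 1) * Rabs (f x)) ->
  gauge d' -> (forall x, lev x = m -> d x = d' x) -> fine_div d a b l ->
  exists l', fine_div d' a b l' /\
    riemann_sum (charf (fun x => f x <> 0 /\ lev x = m)) l
    <= (INR m + 1) * riemann_sum (fun x => Rabs (f x)) l'.
Proof.
  intros Hlev Hd' Hdd [Hl Hf]; revert Hf.
  assert (Hm := pos_INR m).
  induction Hl as [a|a t b c l Hab Ht Hl IH]; intros Hf.
  { exists nil; split; [split; constructor|simpl; lra]. }
  inversion Hf as [|? ? Hp Hf']; subst; simpl in Hp.
  destruct (IH Hf') as [l' [Hl' Hs]].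
  simpl; unfold charf at 1; destruct excluded_middle_informative as [[Hn Hlm]|Hn].
  - exists ([((a, t), b)] ++ l'); split.
    { eapply fine_div_app; eauto; rewrite (Hdd t Hlm) in Hp.
      apply fine_div_single; lra. }
    simpl; specialize (Hlev t Hn); rewrite Hlm in Hlev; nra.
  - destruct (cousin d' a b) as [l0 Hl0]; auto; [lra|].
    exists (l0 ++ l'); split; [eapply fine_div_app; eauto|].
    rewrite riemann_sum_app.
    assert (0 <= riemann_sum (fun x => Rabs (f x)) l0).
    { apply (riemann_sum_nonneg _ a b); [apply Hl0|intros; apply Rabs_pos]. }
    nra.
Qed.

(** The support is the countable union of the sets where |f| >= 1/(m + 1). Each tag uses the gauge
    of its own level, so the levels can be estimated one at a time. *)
Lemma support_sum_small f a b e :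
  HK_integral (fun x => Rabs (f x)) a b 0 -> 0 < e ->
  exists d, gauge d /\ forall l, fine_div d a b l ->
    riemann_sum (charf (fun x => f x <> 0)) l <= e.
Proof.
  intros HI He.
  assert (Hl : forall x, exists m : nat, f x <> 0 -> 1 <= (INR m + 1) * Rabs (f x)).
  { intros x; destruct (Req_dec (f x) 0) as [H0|H0]; [exists O; tauto|].
    assert (Hp := Rabs_pos_lt _ H0).
    destruct (nfloor_ex (/ Rabs (f x))) as [n [_ Hn]].
    { left; apply Rinv_0_lt_compat; auto. }
    exists n; intros _.
    apply Rmult_le_reg_l with (/ Rabs (f x)); [apply Rinv_0_lt_compat; auto|].
    field_simplify; lra. }
  destruct (choice _ Hl) as [lev Hlev].
  (* Dividing by m + 1 compensates the factor in [support_level_sum]; the resulting bounds e / 2^(m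
     + 1) sum to at most e. *)
  set (em := fun m : nat => e * (1 / 2) ^ (S m) / (INR m + 1)).
  assert (Hpow : forall m, 0 < (1 / 2) ^ m) by (intros; apply pow_lt; lra).
  assert (Hem : forall m, 0 < em m).
  { intros m; apply Rdiv_lt_0_compat; [apply Rmult_lt_0_compat; auto|].
    assert (H := pos_INR m); lra. }
  destruct (choice _ (fun m => HK_within_of_integral _ _ _ _ _ HI (Hem m))) as [D HD].
  exists (fun x => D (lev x) x); split; [intros x; apply HD|].
  intros l Hfl.
  assert (Hone : forall m, riemann_sum (charf (fun x => f x <> 0 /\ lev x = m)) l
            <= e * (1 / 2) ^ (S m)).
  { intros m.
    destruct (support_level_sum f lev (fun x => D (lev x) x) (D m) m a b l)
      as [l' [Hl' Hs]]; auto.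
    { apply HD. }
    { intros x ->; auto. }
    apply HD in Hl'; rewrite Rminus_0_r in Hl'.
    apply Rabs_le_between in Hl'.
    assert (Hm := pos_INR m).
    assert (Hx : (INR m + 1) * em m = e * (1 / 2) ^ (S m))
      by (unfold em; field; lra).
    nra. }
  assert (Hall : forall m, riemann_sum (charf (fun x => f x <> 0 /\ (lev x <= m)%nat)) l
            <= e * (1 - (1 / 2) ^ (S m))).
  { induction m as [|m IH].
    - eapply Rle_trans; [|eapply Rle_trans; [apply (Hone O)|simpl; lra]].
      apply (riemann_sum_le _ _ a b); [apply Hfl|]; intros x _.
      unfold charf; repeat destruct excluded_middle_informative; try lra.
      exfalso; apply n; intuition lia.
    - apply Rle_trans with (riemann_sum (fun x =>
        1 * charf (fun x => f x <> 0 /\ (lev x <= m)%nat) x +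
        1 * charf (fun x => f x <> 0 /\ lev x = S m) x) l).
      + apply (riemann_sum_le _ _ a b); [apply Hfl|]; intros x _.
        unfold charf; repeat destruct excluded_middle_informative; try lra.
        exfalso; assert (~ (lev x <= m)%nat) by tauto.
        assert (lev x <> S m) by tauto; lia.
      + rewrite riemann_sum_lin; specialize (Hone (S m)).
        simpl in Hone |- *; simpl in IH; lra. }
  (* One division has finitely many tags, so finitely many levels exhaust the support along it. *)
  assert (HM : exists M, forall m, (M <= m)%nat ->
     riemann_sum (charf (fun x => f x <> 0)) l =
     riemann_sum (charf (fun x => f x <> 0 /\ (lev x <= m)%nat)) l).
  { clear - l; induction l as [|[[x t] y] l [M IH]]; [exists O; auto|].
    exists (Nat.max M (lev t)); intros m Hm; simpl; rewrite (IH m) by lia.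
    f_equal; f_equal; unfold charf.
    repeat destruct excluded_middle_informative; auto; exfalso; intuition lia. }
  destruct HM as [M HM]; rewrite (HM M) by lia.
  eapply Rle_trans; [apply Hall|]; specialize (Hpow (S M)); nra.
Qed.

Definition total_length (L : list (R * R)) : R :=
  fold_right (fun p s => snd p - fst p + s) 0 L.

Lemma total_length_app L L' : total_length (L ++ L') = total_length L + total_length L'.
Proof. induction L as [|p L IH]; simpl; [ring|rewrite IH; ring]. Qed.

(** Past the end of the list the default (0, 0) contributes length 0. *)
Lemma nth_total_length L n :
  Forall (fun p => fst p <= snd p) L ->
  sum_f_R0 (fun k => snd (nth k L (0, 0)) - fst (nth k L (0, 0))) n <= total_length L.
Proof.
  intros HL; revert n; induction HL as [|p L Hp HL IH]; intros n.
  { simpl; rewrite (sum_eq _ (fun _ => 0)); [rewrite sum_cte; lra|].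
    intros [|i] _; simpl; ring. }
  assert (Hnn : 0 <= total_length L).
  { clear - HL; induction HL as [|q L Hq HL IH]; simpl; lra. }
  destruct n as [|n]; [simpl; lra|].
  rewrite decomp_sum by lia; simpl; specialize (IH n); lra.
Qed.

(** [null_set] asks for a single sequence of intervals, whereas bisection yields a finite list at
    each stage. *)
Lemma sequence_of_lists (X : nat -> list (R * R)) (e : R) :
  (forall n, Forall (fun p => fst p <= snd p) (X n)) ->
  (forall n, total_length (concat (map X (seq 0 n))) <= e) ->
  exists a b : nat -> R,
    (forall n, a n <= b n) /\
    (forall m p, In p (X m) -> exists n, a n = fst p /\ b n = snd p) /\
    (forall n, sum_f_R0 (fun k => b k - a k) n <= e).
Proof.
  intros HX He.
  (* padding makes the n-th prefix at least n long *)
  set (C := fun n => concat (map (fun m => (0, 0) :: X m) (seq 0 n))).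
  assert (CS : forall n, C (S n) = C n ++ (0, 0) :: X n).
  { intros n; unfold C; rewrite seq_S, map_app, concat_app; simpl.
    rewrite app_nil_r; auto. }
  assert (Clen : forall n, (n <= length (C n))%nat).
  { induction n as [|n IH]; [lia|]; rewrite CS, length_app; simpl; lia. }
  assert (Cpos : forall n, Forall (fun p => fst p <= snd p) (C n)).
  { induction n as [|n IH]; [constructor|]; rewrite CS; apply Forall_app; split; auto.
    constructor; auto; simpl; lra. }
  assert (Cpre : forall n m i, (n <= m)%nat -> (i < length (C n))%nat ->
            nth i (C m) (0, 0) = nth i (C n) (0, 0) /\ (i < length (C m))%nat).
  { intros n m i Hnm Hi; induction Hnm as [|m Hnm [IH IH']]; auto.
    rewrite CS, length_app, app_nth1; auto; split; auto; lia. }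
  assert (Ctot : forall n, total_length (C n) = total_length (concat (map X (seq 0 n)))).
  { induction n as [|n IH]; auto.
    rewrite CS, seq_S, map_app, concat_app, !total_length_app, IH; simpl.
    rewrite app_nil_r; ring. }
  exists (fun n => fst (nth n (C (S n)) (0, 0))), (fun n => snd (nth n (C (S n)) (0, 0))).
  split; [|split].
  - intros n; assert (H := Cpos (S n)); rewrite Forall_forall in H.
    apply H, nth_In; apply (Clen (S n)).
  - intros m p Hp.
    assert (Hin : In p (C (S m))).
    { rewrite CS; apply in_or_app; right; right; auto. }
    destruct (In_nth _ _ (0, 0) Hin) as [i [Hi Hnth]]; exists i.
    replace (nth i (C (S i)) (0, 0)) with p; auto.
    rewrite <- Hnth; assert (Hl := Clen (S i)).
    destruct (Nat.le_ge_cases m i).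
    + symmetry; apply Cpre; auto; lia.
    + apply Cpre; auto; lia.
  - intros n; apply Rle_trans with (total_length (C (S n))).
    2:{ rewrite Ctot; apply He. }
    eapply Rle_trans; [|apply (nth_total_length _ n), Cpos].
    right; apply sum_eq; intros i Hi.
    assert (Hl := Clen (S i)).
    destruct (Cpre (S i) (S n) i) as [-> _]; auto; lia.
Qed.

(* Bisect [0,1], discarding an interval as soon as it is small compared with the gauge
   at one of its points in [N]; superadditivity of [s] bounds the discarded length. *)
Lemma cover_by_bisection (N : R -> Prop) (d : R -> R) (s : R -> R -> R) e :
  gauge d -> (forall x, N x -> 0 <= x <= 1) ->
  (forall c f, c <= f -> 0 <= s c f) ->
  (forall c m f, c <= m -> m <= f -> s c m + s m f <= s c f) ->
  (forall c t f, c < f -> c <= t <= f -> N t -> t - d t < c -> f < t + d t ->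
     f - c <= s c f) ->
  s 0 1 <= e ->
  exists a b : nat -> R,
    (forall n, a n <= b n) /\
    (forall x, N x -> exists n, a n < x < b n) /\
    (forall n, sum_f_R0 (fun k => b k - a k) n <= 3 * e).
Proof.
  intros Hd HN Hs0 Hsa Hs1 Hse.
  set (good := fun p : R * R => exists t, N t /\ fst p <= t <= snd p /\
                 t - d t < fst p /\ snd p < t + d t).
  (* Tripling a closed interval of positive length puts all its points in the interior; hence the
     factor 3 in the conclusion. *)
  set (kept := fun p => if excluded_middle_informative (good p)
                 then [(fst p - (snd p - fst p), snd p + (snd p - fst p))] else []).
  set (next := fun p => if excluded_middle_informative (good p) then []
                 else [(fst p, (fst p + snd p) / 2); ((fst p + snd p) / 2, snd p)]).
  set (pend := nat_rect (fun _ => list (R * R)) [(0, 1)]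
                 (fun _ L => flat_map next L)).
  set (X := fun n => flat_map kept (pend n)).
  set (mass := fold_right (fun p z => s (fst p) (snd p) + z) 0).
  assert (Hlen : forall n, Forall (fun p => snd p - fst p = (1 / 2) ^ n) (pend n)).
  { induction n as [|n IH]; [repeat constructor; simpl; lra|].
    apply Forall_flat_map; eapply Forall_impl; [|exact IH].
    intros p Hp; unfold next; destruct excluded_middle_informative; [constructor|].
    simpl; repeat constructor; simpl; lra. }
  assert (Hpow : forall n, 0 < (1 / 2) ^ n) by (intros; apply pow_lt; lra).
  (* Discarding an interval trades its mass, which is at least its length, for three times that
     length; bisecting does not raise the mass, by superadditivity. *)
  assert (Hmass : forall n, total_length (concat (map X (seq 0 n))) + 3 * mass (pend n)
                    <= 3 * s 0 1).
  { induction n as [|n IH]; [simpl; lra|].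
    rewrite seq_S, map_app, concat_app, total_length_app; simpl.
    rewrite app_nil_r.
    assert (Hstep : total_length (X n) + 3 * mass (flat_map next (pend n))
              <= 3 * mass (pend n)).
    { unfold X; specialize (Hlen n); clear - Hlen Hpow Hs1 Hsa.
      induction Hlen as [|p L Hp HL IH]; simpl; [lra|].
      specialize (Hpow n).
      assert (Hma : forall A B, mass (A ++ B) = mass A + mass B).
      { induction A as [|q A IHA]; intros B; simpl; [ring|rewrite IHA; ring]. }
      rewrite total_length_app, Hma.
      unfold kept at 1, next at 1.
      destruct excluded_middle_informative as [[t [H1 [H2 [H3 H4]]]]|Hn]; simpl.
      - specialize (Hs1 (fst p) t (snd p) ltac:(lra) H2 H1 H3 H4); lra.
      - specialize (Hsa (fst p) ((fst p + snd p) / 2) (snd p) ltac:(lra) ltac:(lra)); lra. }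
    lra. }
  assert (Hmpos : forall n, 0 <= mass (pend n)).
  { intros n; specialize (Hlen n); clear - Hlen Hpow Hs0.
    induction Hlen as [|p L Hp HL IH]; simpl; [lra|].
    specialize (Hs0 (fst p) (snd p)); specialize (Hpow n); lra. }
  assert (Hcov : forall x, N x -> forall n,
     (exists m p, In p (X m) /\ fst p < x < snd p) \/
     (exists p, In p (pend n) /\ fst p <= x <= snd p)).
  { intros x Hx; induction n as [|n [IH|[p [Hp Hpx]]]].
    - right; exists (0, 1); simpl; auto.
    - left; auto.
    - assert (Hl := Hlen n); rewrite Forall_forall in Hl; specialize (Hl p Hp).
      specialize (Hpow n).
      destruct (excluded_middle_informative (good p)) as [Hg|Hg] eqn:E.
      + left; exists n, (fst p - (snd p - fst p), snd p + (snd p - fst p)).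
        simpl; split; [|lra].
        apply in_flat_map; exists p; split; auto.
        unfold kept; rewrite E; left; auto.
      + right; destruct (Rle_dec x ((fst p + snd p) / 2)).
        * exists (fst p, (fst p + snd p) / 2); simpl; split; [|lra].
          apply in_flat_map; exists p; split; auto.
          unfold next; rewrite E; left; auto.
        * exists ((fst p + snd p) / 2, snd p); simpl; split; [|lra].
          apply in_flat_map; exists p; split; auto.
          unfold next; rewrite E; right; left; auto. }
  destruct (sequence_of_lists X (3 * e)) as [a [b [H1 [H2 H3]]]].
  { intros n; apply Forall_flat_map; eapply Forall_impl; [|apply (Hlen n)].
    intros p Hp; specialize (Hpow n).
    unfold kept; destruct excluded_middle_informative; repeat constructor; simpl; lra. }
  { intros n; specialize (Hmass n); specialize (Hmpos n); lra. }
  exists a, b; split; [|split]; auto.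
  intros x Hx.
  (* Once (1/2)^n is below [d x], a pending interval around x is good with x itself as tag, so it is
     kept at stage n. *)
  assert (Hex : exists m p, In p (X m) /\ fst p < x < snd p).
  { destruct (pow_lt_1_zero (1 / 2)) with (y := d x) as [n Hn]; auto.
    { rewrite Rabs_right; lra. }
    destruct (Hcov x Hx n) as [H|[p [Hp Hpx]]]; auto.
    specialize (Hn n ltac:(lia)); specialize (Hpow n).
    rewrite Rabs_right in Hn by lra.
    assert (Hl := Hlen n); rewrite Forall_forall in Hl; specialize (Hl p Hp).
    exists n, (fst p - (snd p - fst p), snd p + (snd p - fst p)); simpl; split; [|lra].
    apply in_flat_map; exists p; split; auto.
    unfold kept; destruct excluded_middle_informative as [|Hg]; [left; auto|].
    exfalso; apply Hg; exists x; repeat split; auto; lra. }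
  destruct Hex as [m [p [Hp Hpx]]].
  destruct (H2 m p Hp) as [n [Ha Hb]].
  exists n; lra.
Qed.

(** The set function for the bisection is the supremum [s0] of the Riemann sums of the
    characteristic function over fine divisions of an interval: concatenation makes it
    superadditive, a tag in the support makes it at least the length, and on [0, 1] it is at most e
    / 3. *)
Lemma null_set_support f :
  HK_integral (fun x => Rabs (f x)) 0 1 0 -> null_set (fun x => 0 <= x <= 1 /\ f x <> 0).
Proof.
  intros HI e He.
  destruct (support_sum_small f 0 1 (e / 3)) as [d [Hd Hsum]]; auto; [lra|].
  set (chi := charf (fun x => f x <> 0)).
  set (E := fun c b x => exists l, fine_div d c b l /\ x = riemann_sum chi l).
  assert (Hs : forall q : R * R, exists s, fst q <= snd q -> is_lub (E (fst q) (snd q)) s).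
  { intros [c b]; simpl; destruct (classic (c <= b)) as [Hcb|Hcb]; [|exists 0; tauto].
    destruct (completeness (E c b)) as [s Hs].
    - exists (b - c); intros x [l [[Hl _] ->]].
      rewrite <- (Rmult_1_l (b - c)), <- (riemann_sum_const 1 c b l Hl).
      apply (riemann_sum_le _ _ c b); auto; intros; apply charf_bounds.
    - destruct (cousin d c b Hd Hcb) as [l Hl]; exists (riemann_sum chi l), l; auto.
    - exists s; auto. }
  destruct (choice _ Hs) as [s0 Hs0].
  assert (Hlub : forall c b, c <= b -> is_lub (E c b) (s0 (c, b)))
    by (intros c b; apply (Hs0 (c, b))).
  replace e with (3 * (e / 3)) by field.
  apply (cover_by_bisection _ d (fun c b => s0 (c, b))); auto.
  - tauto.
  - intros c b Hcb; destruct (cousin d c b Hd Hcb) as [l Hl].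
    apply Rle_trans with (riemann_sum chi l).
    + apply (riemann_sum_nonneg _ c b); [apply Hl|intros; apply charf_bounds].
    + apply (Hlub c b Hcb); exists l; auto.
  - intros c m b Hcm Hmb.
    assert (H : forall x, E c m x -> s0 (m, b) <= s0 (c, b) - x).
    { intros x [l [Hl ->]]; apply (Hlub m b Hmb); intros y [l' [Hl' ->]].
      assert (riemann_sum chi (l ++ l') <= s0 (c, b)).
      { apply (Hlub c b); [lra|]; exists (l ++ l'); split; auto.
        eapply fine_div_app; eauto. }
      rewrite riemann_sum_app in H; lra. }
    assert (s0 (c, m) <= s0 (c, b) - s0 (m, b)); [|lra].
    apply (Hlub c m Hcm); intros x Hx; specialize (H x Hx); lra.
  - intros c t b Hcb Ht [_ Hft] H1 H2.
    apply (Hlub c b); [lra|]; exists [((c, t), b)]; split.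
    + apply fine_div_single; auto.
    + simpl; unfold chi, charf; destruct excluded_middle_informative; [ring|tauto].
  - apply (Hlub 0 1); [lra|]; intros x [l [Hl ->]]; auto.
Qed.

(** * The extremal solution *)

Definition clamp (a b x : R) : R := Rmax a (Rmin x b).

Lemma clamp_cases a b x :
  a <= b ->
  x <= a /\ clamp a b x = a \/ a <= x <= b /\ clamp a b x = x \/
  b <= x /\ clamp a b x = b.
Proof.
  intros Hab; unfold clamp, Rmax, Rmin; repeat destruct Rle_dec; lra.
Qed.

Lemma clamp_lipschitz a b x z :
  a <= b -> Rabs (clamp a b z - clamp a b x) <= Rabs (z - x).
Proof.
  intros Hab; unfold Rabs; repeat destruct Rcase_abs;
    destruct (clamp_cases a b x Hab) as [[? ?]|[[? ?]|[? ?]]];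
    destruct (clamp_cases a b z Hab) as [[? ?]|[[? ?]|[? ?]]]; lra.
Qed.

Lemma continuous_of_lipschitz f x C :
  (forall z, Rabs (f z - f x) <= C * Rabs (z - x)) -> continuous f x.
Proof.
  intros H; apply continuity_pt_filterlim; intros e He.
  assert (HC := Rabs_pos C).
  exists (e / (Rabs C + 1)); split; [apply Rdiv_lt_0_compat; lra|].
  intros z [_ Hz]; simpl in *; unfold R_dist in *.
  eapply Rle_lt_trans; [apply H|].
  apply Rle_lt_trans with ((Rabs C) * Rabs (z - x)).
  { apply Rmult_le_compat_r; [apply Rabs_pos|apply Rle_abs]. }
  assert (He' : e = (Rabs C + 1) * (e / (Rabs C + 1))) by (field; lra).
  assert (Hq : 0 < e / (Rabs C + 1)) by (apply Rdiv_lt_0_compat; lra).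
  assert (Hz' := Rabs_pos (z - x)).
  nra.
Qed.

(** The extremal functions are built from a clamp with two corners; a quadratic remainder gives
    their derivatives at the corners and elsewhere by one computation. *)
Lemma is_derive_of_quadratic f x l C r :
  0 < r ->
  (forall z, Rabs (z - x) < r -> Rabs (f z - f x - l * (z - x)) <= C * (z - x) ^ 2) ->
  is_derive f x l.
Proof.
  intros Hr H; apply is_derive_Reals; intros e He.
  assert (HC := Rabs_pos C).
  assert (Hp : 0 < Rmin r (e / (Rabs C + 1))).
  { apply Rmin_pos; auto; apply Rdiv_lt_0_compat; lra. }
  exists (mkposreal _ Hp); simpl; intros h Hh0 Hh.
  assert (Hm1 := Rmin_l r (e / (Rabs C + 1))).
  assert (Hm2 := Rmin_r r (e / (Rabs C + 1))).
  specialize (H (x + h)); replace (x + h - x) with h in H by ring.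
  specialize (H ltac:(lra)).
  replace ((f (x + h) - f x) / h - l) with ((f (x + h) - f x - l * h) / h)
    by (field; auto).
  unfold Rdiv; rewrite Rabs_mult, Rabs_inv.
  assert (Hh' := Rabs_pos_lt _ Hh0).
  apply Rmult_lt_reg_r with (Rabs h); auto.
  rewrite Rmult_assoc, Rinv_l, Rmult_1_r by lra.
  assert (H2 : h ^ 2 = Rabs h * Rabs h).
  { rewrite <- Rabs_mult, Rabs_right; [ring|nra]. }
  rewrite H2 in H.
  eapply Rle_lt_trans; [apply H|].
  rewrite <- Rmult_assoc; apply Rmult_lt_compat_r; auto.
  apply Rle_lt_trans with (Rabs C * Rabs h).
  { apply Rmult_le_compat_r; [lra|apply Rle_abs]. }
  assert (He' : e = (Rabs C + 1) * (e / (Rabs C + 1))) by (field; lra).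
  assert (Hq : 0 < e / (Rabs C + 1)) by (apply Rdiv_lt_0_compat; lra).
  nra.
Qed.

(** From exp (- z) >= 1 - z one gets exp z - 1 - z <= z^2 / (1 - z), and 1 - z >= 1/2. *)
Lemma exp_quadratic z : Rabs z <= 1 / 2 -> Rabs (exp z - 1 - z) <= 2 * z ^ 2.
Proof.
  intros Hz; apply Rabs_le_between in Hz.
  assert (H1 := exp_ineq1_le z); assert (H2 := exp_ineq1_le (- z)).
  assert (H3 : exp z * exp (- z) = 1)
    by (rewrite <- exp_plus, Rplus_opp_r; apply exp_0).
  assert (H4 := exp_pos z).
  assert (H5 : exp z * (1 - z) <= 1) by nra.
  assert (H6 : exp z - 1 - z <= 2 * z ^ 2).
  { apply Rmult_le_reg_r with (1 - z); [lra|]; nra. }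
  rewrite Rabs_right; lra.
Qed.

(** In terms of k the pulse has height k^2 on [1/k, 1 - 1/k]; the solution is x before it, exp (k x
    - 1) / k on it, and affine after it. Projecting onto this interval writes the three pieces as
    one formula. *)
Definition pulse_clamp (k : R) : R -> R := clamp (1 / k) (1 - 1 / k).

Definition offset (k x : R) : R := x - pulse_clamp k x.

Definition slope_opt (k x : R) : R := exp (k * (pulse_clamp k x - 1 / k)).

Definition sol_opt (k x : R) : R := slope_opt k x * (offset k x + 1 / k).

(* The diagonal [y z / y 1] of the Green function of the extremal operator, where [z]
   solves the equation from the right end point. *)
Definition green_opt (k x : R) : R := 1 / (2 * k) - k / 2 * offset k x ^ 2.

Lemma inv_le_half k : 2 < k -> 0 < 1 / k < 1 / 2.
Proof.
  intros Hk; split; [apply Rdiv_lt_0_compat; lra|].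
  apply Rmult_lt_reg_r with k; [lra|]; field_simplify; lra.
Qed.

Lemma pulse_clamp_cases k x :
  2 < k ->
  x <= 1 / k /\ pulse_clamp k x = 1 / k \/
  1 / k <= x <= 1 - 1 / k /\ pulse_clamp k x = x \/
  1 - 1 / k <= x /\ pulse_clamp k x = 1 - 1 / k.
Proof. intros Hk; apply clamp_cases; assert (H := inv_le_half k Hk); lra. Qed.

(** Where the offset is nonzero, the clamp starts to move only after the argument has travelled the
    distance |offset|; so either factor vanishes or both are at most |z - x|. *)
Lemma offset_mult_clamp k x z :
  2 < k -> Rabs (offset k x * (pulse_clamp k z - pulse_clamp k x)) <= (z - x) ^ 2.
Proof.
  intros Hk; assert (Hi := inv_le_half k Hk).
  assert (HD : Rabs (pulse_clamp k z - pulse_clamp k x) <= Rabs (z - x))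
    by (apply clamp_lipschitz; lra).
  assert (Hor : pulse_clamp k z - pulse_clamp k x = 0 \/ Rabs (offset k x) <= Rabs (z - x)).
  { unfold offset, Rabs; repeat destruct Rcase_abs;
      destruct (pulse_clamp_cases k x Hk) as [[? ?]|[[? ?]|[? ?]]];
      destruct (pulse_clamp_cases k z Hk) as [[? ?]|[[? ?]|[? ?]]];
      (left; lra) || (right; lra). }
  destruct Hor as [->|Ho].
  - rewrite Rmult_0_r, Rabs_R0; apply pow2_ge_0.
  - rewrite Rabs_mult, <- pow2_abs; simpl; rewrite Rmult_1_r.
    apply Rmult_le_compat; auto; apply Rabs_pos.
Qed.

Lemma pulse_clamp_sq k x z : 2 < k -> (pulse_clamp k z - pulse_clamp k x) ^ 2 <= (z - x) ^ 2.
Proof.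
  intros Hk; assert (Hi := inv_le_half k Hk).
  rewrite <- (pow2_abs (z - x)), <- (pow2_abs (_ - _)).
  apply pow_incr; split; [apply Rabs_pos|apply clamp_lipschitz; lra].
Qed.

Lemma green_opt_derive k x : 2 < k -> is_derive (green_opt k) x (- k * offset k x).
Proof.
  intros Hk; apply (is_derive_of_quadratic _ _ _ (4 * k) 1); [lra|].
  intros z _.
  assert (H1 := offset_mult_clamp k x z Hk).
  assert (H2 := pulse_clamp_sq k x z Hk).
  unfold green_opt; set (D := pulse_clamp k z - pulse_clamp k x) in *.
  assert (Ho : offset k z = offset k x + (z - x) - D) by (unfold offset, D; ring).
  rewrite Ho.
  replace (_ - _ - _) with (k * (offset k x * D) - k / 2 * (z - x - D) ^ 2)
    by (field; lra).
  apply Rabs_le_between in H1.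
  assert (0 <= (z - x - D) ^ 2 <= 4 * (z - x) ^ 2) by nra.
  apply Rabs_le; nra.
Qed.

Lemma slope_opt_pos k x : 0 < slope_opt k x.
Proof. apply exp_pos. Qed.

Lemma slope_opt_quadratic k x z :
  2 < k -> Rabs (z - x) < 1 / (2 * k) ->
  Rabs (slope_opt k z - slope_opt k x
        - slope_opt k x * (k * (pulse_clamp k z - pulse_clamp k x)))
  <= slope_opt k x * (2 * k ^ 2) * (z - x) ^ 2.
Proof.
  intros Hk Hz.
  assert (Hi := inv_le_half k Hk).
  set (D := pulse_clamp k z - pulse_clamp k x).
  assert (HD : Rabs D <= Rabs (z - x)) by (apply clamp_lipschitz; lra).
  assert (HD2 := pulse_clamp_sq k x z Hk); fold D in HD2.
  assert (Hkey : k * (1 / (2 * k)) = 1 / 2) by (field; lra).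
  assert (HkD : Rabs (k * D) <= 1 / 2).
  { rewrite Rabs_mult, (Rabs_right k) by lra; nra. }
  apply exp_quadratic in HkD.
  assert (Hz' : slope_opt k z = slope_opt k x * exp (k * D)).
  { unfold slope_opt, D; rewrite <- exp_plus; f_equal; ring. }
  rewrite Hz'.
  replace (_ - _ - _) with (slope_opt k x * (exp (k * D) - 1 - k * D)) by ring.
  assert (Hp := slope_opt_pos k x).
  rewrite Rabs_mult, (Rabs_right (slope_opt k x)), Rmult_assoc by lra.
  apply Rmult_le_compat_l; [lra|].
  eapply Rle_trans; [apply HkD|]; rewrite Rpow_mult_distr.
  assert (0 < k ^ 2) by nra; nra.
Qed.

(** With D the increment of the clamp, the first-order terms k D (1/k) from the exponential and - D
    from the offset cancel, also at the corners; the rest is of second order by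
    [offset_mult_clamp]. *)
Lemma sol_opt_derive k x : 2 < k -> is_derive (sol_opt k) x (slope_opt k x).
Proof.
  intros Hk.
  assert (Hi := inv_le_half k Hk).
  assert (Hp := slope_opt_pos k x).
  set (C := slope_opt k x * (2 * k ^ 2)).
  apply (is_derive_of_quadratic _ _ _
    (C * (Rabs (offset k x) + 3 + 1 / k) + 3 * k * slope_opt k x) (1 / (2 * k))).
  { apply Rdiv_lt_0_compat; lra. }
  intros z Hz.
  assert (H1 := slope_opt_quadratic k x z Hk Hz); fold C in H1.
  assert (H2 := offset_mult_clamp k x z Hk).
  assert (H3 := pulse_clamp_sq k x z Hk).
  assert (Hk2 : 1 / (2 * k) < 1 / 4).
  { apply Rmult_lt_reg_r with (2 * k); [lra|]; field_simplify; lra. }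
  set (D := pulse_clamp k z - pulse_clamp k x) in *.
  assert (HD : Rabs D <= Rabs (z - x)) by (apply clamp_lipschitz; lra).
  assert (Ho : offset k z = offset k x + (z - x) - D) by (unfold offset, D; ring).
  set (E := slope_opt k z - slope_opt k x - slope_opt k x * (k * D)) in *.
  assert (Hs : slope_opt k z = slope_opt k x + slope_opt k x * (k * D) + E)
    by (unfold E; ring).
  unfold sol_opt; rewrite Ho, Hs.
  replace (_ - _ - _) with
    (E * (offset k x + (z - x) - D + 1 / k) +
     slope_opt k x * k * (offset k x * D + D * (z - x) - D ^ 2)) by (field; lra).
  assert (HC : 0 <= C) by (unfold C; assert (0 < k ^ 2) by nra; nra).
  eapply Rle_trans; [apply Rabs_triang|]; rewrite !Rabs_mult.
  rewrite (Rabs_right k), (Rabs_right (slope_opt k x)) by lra.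
  assert (H4 : Rabs (offset k x + (z - x) - D + 1 / k) <= Rabs (offset k x) + 3 + 1 / k).
  { revert HD Hz; unfold Rabs; repeat destruct Rcase_abs; lra. }
  assert (H5 : Rabs (offset k x * D + D * (z - x) - D ^ 2) <= 3 * (z - x) ^ 2).
  { apply Rabs_le_between in H2; apply Rabs_le; nra. }
  apply Rle_trans with
    (C * (z - x) ^ 2 * (Rabs (offset k x) + 3 + 1 / k) +
     slope_opt k x * k * (3 * (z - x) ^ 2)).
  - apply Rplus_le_compat.
    + apply Rmult_le_compat; auto; apply Rabs_pos.
    + apply Rmult_le_compat_l; auto; nra.
  - right; ring.
Qed.

Lemma slope_opt_continuous k x : 2 < k -> continuous (slope_opt k) x.
Proof.
  intros Hk; unfold slope_opt.
  apply (continuous_comp (fun x => k * (pulse_clamp k x - 1 / k)) exp).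
  - apply (continuous_of_lipschitz _ _ k); intros z.
    replace (_ - _) with (k * (pulse_clamp k z - pulse_clamp k x)) by ring.
    rewrite Rabs_mult, (Rabs_right k) by lra.
    apply Rmult_le_compat_l; [lra|]; apply clamp_lipschitz.
    assert (Hi := inv_le_half k Hk); lra.
  - apply (ex_derive_continuous exp); auto_derive; auto.
Qed.

Definition pot_opt (k : R) (x : R) : R := k ^ 2 * indicator (1 / k) (1 - 1 / k) x.

Lemma pulse_clamp_derive k x :
  2 < k -> x <> 1 / k -> x <> 1 - 1 / k ->
  is_derive (pulse_clamp k) x (indicator (1 / k) (1 - 1 / k) x).
Proof.
  intros Hk H1 H2; assert (Hi := inv_le_half k Hk).
  assert (Hr : 0 < Rmin (Rabs (x - 1 / k)) (Rabs (x - (1 - 1 / k)))).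
  { apply Rmin_pos; apply Rabs_pos_lt; lra. }
  apply (is_derive_of_quadratic _ _ _ 0 _ Hr).
  intros z Hz.
  assert (Hm1 := Rmin_l (Rabs (x - 1 / k)) (Rabs (x - (1 - 1 / k)))).
  assert (Hm2 := Rmin_r (Rabs (x - 1 / k)) (Rabs (x - (1 - 1 / k)))).
  assert (Hz1 := Rlt_le_trans _ _ _ Hz Hm1).
  assert (Hz2 := Rlt_le_trans _ _ _ Hz Hm2).
  rewrite Rmult_0_l; right; rewrite <- Rabs_R0; f_equal.
  revert Hz1 Hz2; unfold indicator, Rabs; repeat destruct Rcase_abs;
    repeat destruct Rle_dec; intros;
    destruct (pulse_clamp_cases k x Hk) as [[? ->]|[[? ->]|[? ->]]];
    destruct (pulse_clamp_cases k z Hk) as [[? ->]|[[? ->]|[? ->]]]; lra.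
Qed.

Lemma slope_opt_derive k x :
  2 < k -> x <> 1 / k -> x <> 1 - 1 / k ->
  is_derive (slope_opt k) x (pot_opt k x * sol_opt k x).
Proof.
  intros Hk H1 H2; assert (Hi := inv_le_half k Hk).
  assert (Hc := pulse_clamp_derive k x Hk H1 H2).
  unfold slope_opt.
  evar_last.
  { apply (is_derive_comp exp (fun x => k * (pulse_clamp k x - 1 / k))).
    - apply is_derive_exp.
    - apply is_derive_scal, (is_derive_minus (pulse_clamp k) (fun _ => 1 / k)).
      + exact Hc.
      + apply is_derive_const. }
  unfold pot_opt, sol_opt, slope_opt, scal, minus, plus, opp, zero; simpl.
  unfold mult; simpl.
  unfold indicator, offset; repeat destruct Rle_dec;
    destruct (pulse_clamp_cases k x Hk) as [[? ->]|[[? ->]|[? ->]]]; try lra;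
    field; lra.
Qed.

Lemma offset_bounds k x : 2 < k -> 0 <= x <= 1 -> -1 / k <= offset k x <= 1 / k.
Proof.
  intros Hk Hx; assert (Hi := inv_le_half k Hk).
  assert (Hn : -1 / k = - (1 / k)) by (field; lra); rewrite Hn.
  unfold offset; destruct (pulse_clamp_cases k x Hk) as [[? ->]|[[? ->]|[? ->]]]; lra.
Qed.

Lemma offset_gt k x : 2 < k -> 0 < x -> - (1 / k) < offset k x.
Proof.
  intros Hk Hx; assert (Hi := inv_le_half k Hk); unfold offset.
  destruct (pulse_clamp_cases k x Hk) as [[? ->]|[[? ->]|[? ->]]]; lra.
Qed.

Lemma offset_lt k x : 2 < k -> x < 1 -> offset k x < 1 / k.
Proof.
  intros Hk Hx; assert (Hi := inv_le_half k Hk); unfold offset.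
  destruct (pulse_clamp_cases k x Hk) as [[? ->]|[[? ->]|[? ->]]]; lra.
Qed.

Lemma sol_opt_pos k x : 2 < k -> 0 < x -> 0 < sol_opt k x.
Proof.
  intros Hk Hx; apply Rmult_lt_0_compat; [apply exp_pos|].
  assert (H := offset_gt k x Hk Hx); lra.
Qed.

Lemma sol_opt_left k x : 2 < k -> x <= 1 / k -> sol_opt k x = x.
Proof.
  intros Hk Hx; assert (Hi := inv_le_half k Hk); unfold sol_opt, slope_opt, offset.
  destruct (pulse_clamp_cases k x Hk) as [[? ->]|[[? Hs]|[? Hs]]].
  - rewrite Rminus_diag, Rmult_0_r, exp_0; ring.
  - rewrite Hs; replace x with (1 / k) by lra.
    rewrite Rminus_diag, Rmult_0_r, exp_0; ring.
  - lra.
Qed.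

Lemma sol_opt_1 k : 2 < k -> sol_opt k 1 = 2 / k * exp (k - 2).
Proof.
  intros Hk; assert (Hi := inv_le_half k Hk); unfold sol_opt, slope_opt, offset.
  destruct (pulse_clamp_cases k 1 Hk) as [[? ->]|[[? Hs]|[? ->]]]; try lra.
  replace (k * (1 - 1 / k - 1 / k)) with (k - 2) by (field; lra).
  field; lra.
Qed.

Lemma green_opt_factor k x :
  2 < k -> green_opt k x = k / 2 * ((1 / k - offset k x) * (1 / k + offset k x)).
Proof. intros Hk; unfold green_opt; field; lra. Qed.

Lemma green_opt_bounds k x : 2 < k -> 0 <= x <= 1 -> 0 <= green_opt k x <= 1 / (2 * k).
Proof.
  intros Hk Hx; assert (Ho := offset_bounds k x Hk Hx).
  assert (-1 / k = - (1 / k)) by (field; lra).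
  split.
  - rewrite green_opt_factor by auto.
    apply Rmult_le_pos; [lra|]; apply Rmult_le_pos; lra.
  - unfold green_opt; assert (H2 := pow2_ge_0 (offset k x)); nra.
Qed.

Lemma green_opt_pos k x : 2 < k -> 0 < x < 1 -> 0 < green_opt k x.
Proof.
  intros Hk Hx; rewrite green_opt_factor by auto.
  assert (H1 := offset_gt k x Hk (proj1 Hx)).
  assert (H2 := offset_lt k x Hk (proj2 Hx)).
  apply Rmult_lt_0_compat; [lra|]; apply Rmult_lt_0_compat; lra.
Qed.

Lemma green_opt_1 k : 2 < k -> green_opt k 1 = 0.
Proof.
  intros Hk; assert (Hi := inv_le_half k Hk); unfold green_opt, offset.
  destruct (pulse_clamp_cases k 1 Hk) as [[? ->]|[[? Hs]|[? ->]]]; try lra.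
  field; lra.
Qed.

Lemma green_opt_left k x : 2 < k -> x <= 1 / k -> green_opt k x = x * (1 - k * x / 2).
Proof.
  intros Hk Hx; assert (Hi := inv_le_half k Hk); unfold green_opt, offset.
  destruct (pulse_clamp_cases k x Hk) as [[? ->]|[[? Hs]|[? Hs]]].
  - field; lra.
  - rewrite Hs; replace x with (1 / k) by lra; field; lra.
  - lra.
Qed.

(** * The calibration argument *)

(* [Y] solves [Y'' = W Y] with [0 <= W <= |V|], where [F] is the primitive of [|V|];
   the last clause is the integrated form of [W <= |V|]. *)
Record subsolution (F P Y : R -> R) : Prop := {
  sub_derive : forall x, 0 <= x <= 1 -> is_derive Y x (P x);
  sub_cont : forall x, 0 <= x <= 1 -> continuous P x;
  sub_init : P 0 = 1;
  sub_bounds : forall x, 0 <= x <= 1 -> x <= Y x <= x * P x;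
  sub_budget0 : F 0 = 0;
  sub_budget : forall c d, 0 <= c -> c <= d -> d <= 1 -> F c <= F d;
  sub_slope : forall c d, 0 <= c -> c <= d -> d <= 1 -> P c <= P d;
  sub_growth : forall c d, 0 <= c -> c <= d -> d <= 1 -> P d - P c <= Y d * (F d - F c)
}.

(** The calibration function with the slope frozen at a number [p] and without the budget term: what
    remains is differentiable in x. *)
Definition calib_smooth (k : R) (Y : R -> R) (p x : R) : R :=
  p * (green_opt k x / Y x) + ln (Y x) - ln (sol_opt k x) + k * x / 2.

Definition calib (k : R) (F P Y : R -> R) (x : R) : R :=
  calib_smooth k Y (P x) x - F x / (2 * k).

Lemma sub_pos F P Y x : subsolution F P Y -> 0 < x <= 1 -> 0 < Y x.
Proof. intros HS Hx; assert (H := sub_bounds _ _ _ HS x ltac:(lra)); lra. Qed.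

(** A discrete product rule: the increment of [P] is weighted at the right end [d], where the factor
    [Y d] of [sub_growth] cancels the denominator and g <= 1/(2k) lets the budget term absorb it. *)
Lemma calib_increment k F P Y c d :
  2 < k -> subsolution F P Y -> 0 < c -> c <= d -> d <= 1 ->
  calib k F P Y d - calib k F P Y c
  <= calib_smooth k Y (P c) d - calib_smooth k Y (P c) c.
Proof.
  intros Hk HS Hc Hcd Hd.
  assert (HY := sub_pos _ _ _ d HS ltac:(lra)).
  assert (Hgr := sub_growth _ _ _ HS c d ltac:(lra) Hcd Hd).
  assert (HF := sub_budget _ _ _ HS c d ltac:(lra) Hcd Hd).
  assert (Hg := green_opt_bounds k d Hk ltac:(lra)).
  assert (Hmain : (P d - P c) * (green_opt k d / Y d) <= (F d - F c) / (2 * k)).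
  { apply Rle_trans with ((Y d * (F d - F c)) * (green_opt k d / Y d)).
    - apply Rmult_le_compat_r; auto.
      apply Rmult_le_pos; [lra|left; apply Rinv_0_lt_compat; auto].
    - replace ((Y d * (F d - F c)) * (green_opt k d / Y d)) with
        ((F d - F c) * green_opt k d) by (field; lra).
      replace ((F d - F c) / (2 * k)) with ((F d - F c) * (1 / (2 * k))) by (field; lra).
      apply Rmult_le_compat_l; lra. }
  unfold calib, calib_smooth.
  replace ((F d - F c) / (2 * k)) with (F d / (2 * k) - F c / (2 * k)) in Hmain
    by (field; lra).
  lra.
Qed.

(** With u = P/Y and v = [slope_opt] / [sol_opt], the identities g' = 2 g v - 1 and g v^2 - v + k/2
    = 0 complete the square. *)
Lemma calib_smooth_derive k F P Y t :
  2 < k -> subsolution F P Y -> 0 < t <= 1 ->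
  is_derive (calib_smooth k Y (P t)) t
    (- (green_opt k t * (P t / Y t - slope_opt k t / sol_opt k t) ^ 2)).
Proof.
  intros Hk HS Ht.
  assert (HY := sub_pos _ _ _ t HS Ht).
  assert (Hs := sol_opt_pos k t Hk (proj1 Ht)).
  assert (HdY := sub_derive _ _ _ HS t ltac:(lra)).
  assert (Hdg := green_opt_derive k t Hk).
  assert (Hds := sol_opt_derive k t Hk).
  unfold calib_smooth; auto_derive.
  { repeat split; auto; try lra; eexists; eauto. }
  replace (Derive (fun x : R => Y x) t) with (P t)
    by (symmetry; apply is_derive_unique; auto).
  replace (Derive (fun x : R => green_opt k x) t) with (- k * offset k t)
    by (symmetry; apply is_derive_unique; auto).
  replace (Derive (fun x : R => sol_opt k x) t) with (slope_opt k t)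
    by (symmetry; apply is_derive_unique; auto).
  assert (Hp := slope_opt_pos k t).
  assert (Ho := offset_gt k t Hk (proj1 Ht)).
  assert (0 < 1 / k) by (apply Rdiv_lt_0_compat; lra).
  assert (Hk0 : offset k t * k + 1 <> 0).
  { replace (offset k t * k + 1) with (k * (offset k t + 1 / k)) by (field; lra).
    apply Rmult_integral_contrapositive; split; lra. }
  unfold green_opt, sol_opt; field; repeat split; lra.
Qed.

(** [calib_increment] freezes the slope at [c], the derivative is known for the slope at the tag
    [t]. The difference (P c - P t) (G d - G c) is small compared with d - c, as [P] is continuous
    and G = g/Y is differentiable at [t]. *)
Lemma calib_nonincreasing k F P Y a b :
  2 < k -> subsolution F P Y -> 0 < a -> a <= b -> b <= 1 ->
  calib k F P Y b <= calib k F P Y a.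
Proof.
  intros Hk HS Ha Hab Hb.
  apply le_epsilon; intros e He.
  set (e' := e / 2).
  assert (Hrel : calib k F P Y b - calib k F P Y a <= 2 * e' * (b - a)).
  { apply (cousin_rel (fun c d => calib k F P Y d - calib k F P Y c
                                   <= 2 * e' * (d - c)) a b); auto.
    - intros; lra.
    - intros; lra.
    - intros t Ht.
      assert (HD := calib_smooth_derive k F P Y t Hk HS ltac:(lra)).
      set (G := fun x => green_opt k x / Y x).
      assert (HYt := sub_pos _ _ _ t HS ltac:(lra)).
      assert (HG : exists g', is_derive G t g').
      { assert (HdY := sub_derive _ _ _ HS t ltac:(lra)).
        assert (Hdg := green_opt_derive k t Hk).
        unfold G; eexists; apply is_derive_div; eauto; lra. }
      destruct HG as [g' HG].
      destruct (is_derive_straddle _ _ _ e' HD) as [r1 [Hr1 H1]]; [unfold e'; lra|].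
      destruct (is_derive_straddle _ _ _ 1 HG) as [r2 [Hr2 H2]]; [lra|].
      assert (Hc := sub_cont _ _ _ HS t ltac:(lra)).
      apply continuity_pt_filterlim in Hc.
      assert (Hg' := Rabs_pos g').
      destruct (Hc (e' / (Rabs g' + 1))) as [r3 [Hr3 H3]].
      { apply Rdiv_lt_0_compat; unfold e'; lra. }
      exists (Rmin r1 (Rmin r2 r3)); split; [repeat apply Rmin_pos; auto|].
      intros c d C1 C2 C3 C4 C5 C6 C7.
      assert (M1 := Rmin_l r1 (Rmin r2 r3)); assert (M2 := Rmin_r r1 (Rmin r2 r3)).
      assert (M3 := Rmin_l r2 r3); assert (M4 := Rmin_r r2 r3).
      specialize (H1 c d C2 C3 ltac:(lra) ltac:(lra)).
      specialize (H2 c d C2 C3 ltac:(lra) ltac:(lra)).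
      assert (HPc : Rabs (P c - P t) <= e' / (Rabs g' + 1)).
      { destruct (Req_dec c t) as [->|Hne].
        - rewrite Rminus_diag, Rabs_R0; left; apply Rdiv_lt_0_compat; unfold e'; lra.
        - left; apply H3; split; [split; [exact I|auto]|].
          simpl; unfold R_dist; apply Rabs_def1; lra. }
      eapply Rle_trans; [apply calib_increment; auto; lra|].
      replace (calib_smooth k Y (P c) d - calib_smooth k Y (P c) c) with
        (calib_smooth k Y (P t) d - calib_smooth k Y (P t) c +
         (P c - P t) * (G d - G c)) by (unfold calib_smooth, G; ring).
      assert (HGdc : Rabs (G d - G c) <= (Rabs g' + 1) * (d - c)).
      { replace (G d - G c) with ((G d - G c - g' * (d - c)) + g' * (d - c)) by ring.
        eapply Rle_trans; [apply Rabs_triang|].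
        rewrite Rabs_mult, (Rabs_right (d - c)) by lra; lra. }
      assert (Hprod : (P c - P t) * (G d - G c) <= e' * (d - c)).
      { eapply Rle_trans; [apply Rle_abs|]; rewrite Rabs_mult.
        apply Rle_trans with (e' / (Rabs g' + 1) * ((Rabs g' + 1) * (d - c))).
        - apply Rmult_le_compat; auto; apply Rabs_pos.
        - right; field; lra. }
      assert (Hdef : 0 <= green_opt k t * (P t / Y t - slope_opt k t / sol_opt k t) ^ 2).
      { apply Rmult_le_pos; [apply green_opt_bounds; lra|apply pow2_ge_0]. }
      apply Rabs_le_between in H1.
      assert (0 <= green_opt k t * (P t / Y t - slope_opt k t / sol_opt k t) ^ 2 * (d - c))
        by (apply Rmult_le_pos; lra).
      lra. }
  assert (2 * e' * (b - a) <= e) by (unfold e'; nra).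
  lra.
Qed.

(** The logarithmic singularities at 0 cancel: ln Y - ln x <= ln P <= P - 1. The first term is at
    most P because g <= x <= Y. *)
Lemma calib_left k F P Y x :
  2 < k -> subsolution F P Y -> 0 < x -> x <= 1 / k ->
  calib k F P Y x <= 2 * P x - 1 + k * x / 2.
Proof.
  intros Hk HS Hx Hxk.
  assert (Hi := inv_le_half k Hk).
  assert (HY := sub_bounds _ _ _ HS x ltac:(lra)).
  assert (HP := sub_slope _ _ _ HS 0 x ltac:(lra) ltac:(lra) ltac:(lra)).
  rewrite (sub_init _ _ _ HS) in HP.
  assert (HF := sub_budget _ _ _ HS 0 x ltac:(lra) ltac:(lra) ltac:(lra)).
  rewrite (sub_budget0 _ _ _ HS) in HF.
  unfold calib, calib_smooth.
  rewrite sol_opt_left, green_opt_left by auto.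
  assert (HF' : 0 <= F x / (2 * k)).
  { apply Rmult_le_pos; auto; left; apply Rinv_0_lt_compat; lra. }
  assert (Hln : ln (Y x) - ln x <= P x - 1).
  { assert (ln (Y x) <= ln (x * P x)) by (apply ln_le; lra).
    rewrite ln_mult in H by lra.
    assert (ln (P x) <= P x - 1); [|lra].
    assert (He := exp_ineq1_le (ln (P x))); rewrite exp_ln in He; lra. }
  assert (Hkx : 0 <= k * x <= 1).
  { split; [nra|]; apply Rle_trans with (k * (1 / k)); [nra|right; field; lra]. }
  assert (Hq : P x * (x * (1 - k * x / 2) / Y x) <= P x).
  { rewrite <- (Rmult_1_r (P x)) at 2; apply Rmult_le_compat_l; [lra|].
    apply Rmult_le_reg_r with (Y x); [lra|].
    unfold Rdiv at 1; rewrite Rmult_assoc, Rinv_l by lra; nra. }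
  lra.
Qed.

Lemma sub_slope_near0 F P Y k e :
  2 < k -> subsolution F P Y -> 0 < e ->
  exists r, 0 < r <= 1 / k /\ forall x, 0 < x <= r ->
    P x <= 1 + e /\ 2 * P x - 1 + k * x / 2 <= 1 + e.
Proof.
  intros Hk HS He; assert (Hi := inv_le_half k Hk).
  assert (Hc := sub_cont _ _ _ HS 0 ltac:(lra)).
  apply continuity_pt_filterlim in Hc.
  destruct (Hc (e / 4)) as [r [Hr H]]; [lra|].
  set (s := Rmin (r / 2) (Rmin (1 / k) (e / k))).
  assert (Hs : 0 < s).
  { unfold s; repeat apply Rmin_pos; try lra; apply Rdiv_lt_0_compat; lra. }
  assert (M1 : s <= r / 2) by apply Rmin_l.
  assert (M2 : s <= 1 / k)
    by (eapply Rle_trans; [apply Rmin_r|apply Rmin_l]).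
  assert (M3 : s <= e / k)
    by (eapply Rle_trans; [apply Rmin_r|apply Rmin_r]).
  exists s; split; [lra|]; intros x Hx.
  assert (HP : Rabs (P x - P 0) < e / 4).
  { apply H; split; [split; [exact I|lra]|].
    simpl; unfold R_dist; rewrite Rminus_0_r, Rabs_right; lra. }
  rewrite (sub_init _ _ _ HS) in HP; apply Rabs_def2 in HP.
  assert (k * x <= e).
  { apply Rle_trans with (k * (e / k)); [nra|right; field; lra]. }
  lra.
Qed.

Lemma calib_le_1 k F P Y x :
  2 < k -> subsolution F P Y -> 0 < x <= 1 -> calib k F P Y x <= 1.
Proof.
  intros Hk HS Hx; apply le_epsilon; intros e He.
  destruct (sub_slope_near0 F P Y k e Hk HS He) as [r [Hr H]].
  assert (Hi := inv_le_half k Hk).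
  set (z := Rmin r x).
  assert (Hz : 0 < z) by (apply Rmin_pos; lra).
  assert (Hz1 : z <= r) by apply Rmin_l.
  assert (Hz2 : z <= x) by apply Rmin_r.
  apply Rle_trans with (calib k F P Y z).
  { apply calib_nonincreasing; auto; lra. }
  eapply Rle_trans; [apply calib_left; auto; lra|].
  apply H; lra.
Qed.

(** The Green function vanishes at 1, which removes the unknown slope [P 1]; the constant is k/2 -
    (k^2 - 2 k)/(2 k) = 1. *)
Lemma calib_at_1 k F P Y :
  2 < k -> subsolution F P Y -> F 1 <= k ^ 2 - 2 * k ->
  ln (Y 1) - ln (sol_opt k 1) + 1 <= calib k F P Y 1.
Proof.
  intros Hk HS HF; unfold calib, calib_smooth; rewrite green_opt_1 by auto.
  assert (F 1 / (2 * k) <= k / 2 - 1).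
  { apply Rmult_le_reg_r with (2 * k); [lra|]; field_simplify; lra. }
  assert (P 1 * (0 / Y 1) = 0) by (unfold Rdiv; ring).
  lra.
Qed.

Lemma subsolution_bound k F P Y :
  2 < k -> subsolution F P Y -> F 1 <= k ^ 2 - 2 * k -> Y 1 <= sol_opt k 1.
Proof.
  intros Hk HS HF.
  assert (H1 := calib_at_1 k F P Y Hk HS HF).
  assert (H2 := calib_le_1 k F P Y 1 Hk HS ltac:(lra)).
  assert (HY := sub_pos _ _ _ 1 HS ltac:(lra)).
  assert (Hs := sol_opt_pos k 1 Hk ltac:(lra)).
  apply Rnot_lt_le; intros Hlt.
  assert (H := ln_increasing _ _ Hs Hlt); lra.
Qed.

Lemma subsolution_rigid_ratio k F P Y t :
  2 < k -> subsolution F P Y -> F 1 <= k ^ 2 - 2 * k -> Y 1 = sol_opt k 1 ->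
  0 < t < 1 -> P t / Y t = slope_opt k t / sol_opt k t.
Proof.
  intros Hk HS HF Heq Ht.
  assert (Hconst : forall x, 0 < x <= 1 -> calib k F P Y x = 1).
  { intros x Hx; apply Rle_antisym; [apply calib_le_1; auto|].
    assert (H1 := calib_at_1 k F P Y Hk HS HF); rewrite Heq in H1.
    assert (H2 := calib_nonincreasing k F P Y x 1 Hk HS ltac:(lra) ltac:(lra) ltac:(lra)).
    lra. }
  set (D := green_opt k t * (P t / Y t - slope_opt k t / sol_opt k t) ^ 2).
  assert (HD : D <= 0).
  { apply le_epsilon; intros e He.
    destruct (is_derive_straddle _ _ _ e
      (calib_smooth_derive k F P Y t Hk HS ltac:(lra)) He) as [r [Hr H]].
    set (d := Rmin 1 (t + r / 2)).
    assert (Hd1 : d <= 1) by apply Rmin_l.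
    assert (Hd2 : d <= t + r / 2) by apply Rmin_r.
    assert (Hd3 : t < d) by (apply Rmin_glb_lt; lra).
    specialize (H t d ltac:(lra) ltac:(lra) ltac:(lra) ltac:(lra)); fold D in H.
    assert (Hinc := calib_increment k F P Y t d Hk HS ltac:(lra) ltac:(lra) ltac:(lra)).
    rewrite (Hconst d), (Hconst t) in Hinc by lra.
    apply Rabs_le_between in H.
    assert (D * (d - t) <= e * (d - t)) by lra.
    apply Rmult_le_reg_r with (d - t); lra. }
  assert (Hg := green_opt_pos k t Hk Ht).
  unfold D in HD; set (z := P t / Y t - slope_opt k t / sol_opt k t) in *.
  assert (Hz := pow2_ge_0 z).
  assert (z ^ 2 = 0) by nra.
  assert (z = 0) by (apply Rsqr_0_uniq; unfold Rsqr; lra).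
  unfold z in *; lra.
Qed.

(** Equal logarithmic derivatives make Y / [sol_opt] constant on (0, 1), and the constant is 1
    because both functions behave like x at 0. The slope at 1 follows by continuity. *)
Lemma subsolution_rigid k F P Y :
  2 < k -> subsolution F P Y -> F 1 <= k ^ 2 - 2 * k -> Y 1 = sol_opt k 1 ->
  forall x, 0 <= x <= 1 -> Y x = sol_opt k x /\ P x = slope_opt k x.
Proof.
  intros Hk HS HF Heq; assert (Hi := inv_le_half k Hk).
  assert (HYin : forall x, 0 < x < 1 -> Y x = sol_opt k x).
  { intros x Hx.
    set (q := fun x => Y x / sol_opt k x).
    assert (Hq : forall z, 0 < z < 1 -> is_derive q z 0).
    { intros z Hz; unfold q.
      assert (HYz := sub_pos _ _ _ z HS ltac:(lra)).
      assert (Hsz := sol_opt_pos k z Hk (proj1 Hz)).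
      evar_last.
      { apply is_derive_div; [apply (sub_derive _ _ _ HS); lra
          |apply sol_opt_derive; auto|lra]. }
      assert (Hr := subsolution_rigid_ratio k F P Y z Hk HS HF Heq Hz).
      assert (HP : P z = slope_opt k z / sol_opt k z * Y z) by (rewrite <- Hr; field; lra).
      rewrite HP; field; lra. }
    assert (Hc : forall z, 0 < z < 1 -> q z = q x).
    { intros z Hz.
      destruct (MVT_gen q z x (fun _ => 0)) as [c [_ Hc]].
      - intros y Hy; apply Hq; revert Hy; unfold Rmin, Rmax; destruct Rle_dec; lra.
      - intros y Hy; apply continuity_pt_filterlim, (ex_derive_continuous q).
        exists 0; apply Hq; revert Hy; unfold Rmin, Rmax; destruct Rle_dec; lra.
      - lra. }
    assert (Hq1 : q x = 1).
    { assert (Hb : forall e, 0 < e -> 1 <= q x <= 1 + e).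
      { intros e He.
        destruct (sub_slope_near0 F P Y k e Hk HS He) as [r [Hr H]].
        rewrite <- (Hc r) by lra; unfold q; rewrite sol_opt_left by lra.
        assert (HY := sub_bounds _ _ _ HS r ltac:(lra)).
        specialize (H r ltac:(lra)).
        split; apply Rmult_le_reg_r with r; try lra;
          unfold Rdiv; rewrite Rmult_assoc, Rinv_l by lra; nra. }
      apply Rle_antisym.
      - apply le_epsilon; intros e He; apply Hb; auto.
      - apply (Hb 1); lra. }
    assert (Hs := sol_opt_pos k x Hk (proj1 Hx)).
    unfold q in Hq1; replace (Y x) with (Y x / sol_opt k x * sol_opt k x) by (field; lra).
    rewrite Hq1; ring. }
  assert (HY0 : Y 0 = sol_opt k 0).
  { rewrite sol_opt_left by lra.
    assert (H := sub_bounds _ _ _ HS 0 ltac:(lra)); lra. }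
  assert (HPin : forall x, 0 < x < 1 -> P x = slope_opt k x).
  { intros x Hx.
    assert (Hr := subsolution_rigid_ratio k F P Y x Hk HS HF Heq Hx).
    assert (Hs := sol_opt_pos k x Hk (proj1 Hx)).
    rewrite (HYin x Hx) in Hr.
    apply Rmult_eq_reg_r with (/ sol_opt k x); [exact Hr|].
    apply Rinv_neq_0_compat; lra. }
  assert (HP0 : P 0 = slope_opt k 0).
  { rewrite (sub_init _ _ _ HS); unfold slope_opt.
    destruct (pulse_clamp_cases k 0 Hk) as [[? ->]|[[? Hs]|[? Hs]]]; try lra.
    rewrite Rminus_diag, Rmult_0_r, exp_0; auto. }
  assert (HP1 : P 1 = slope_opt k 1).
  { apply cond_eq; intros e He.
    assert (C1 := sub_cont _ _ _ HS 1 ltac:(lra)).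
    assert (C2 := slope_opt_continuous k 1 Hk).
    apply continuity_pt_filterlim in C1; apply continuity_pt_filterlim in C2.
    destruct (C1 (e / 2)) as [r1 [Hr1 H1]]; [lra|].
    destruct (C2 (e / 2)) as [r2 [Hr2 H2]]; [lra|].
    set (s := Rmin (1 / 2) (Rmin (r1 / 2) (r2 / 2))).
    assert (Hs : 0 < s) by (unfold s; repeat apply Rmin_pos; lra).
    assert (M1 : s <= 1 / 2) by apply Rmin_l.
    assert (M2 : s <= r1 / 2) by (eapply Rle_trans; [apply Rmin_r|apply Rmin_l]).
    assert (M3 : s <= r2 / 2) by (eapply Rle_trans; [apply Rmin_r|apply Rmin_r]).
    assert (E1 : Rabs (P (1 - s) - P 1) < e / 2).
    { apply H1; split; [split; [exact I|lra]|].
      simpl; unfold R_dist; apply Rabs_def1; lra. }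
    assert (E2 : Rabs (slope_opt k (1 - s) - slope_opt k 1) < e / 2).
    { apply H2; split; [split; [exact I|lra]|].
      simpl; unfold R_dist; apply Rabs_def1; lra. }
    rewrite (HPin (1 - s)) in E1 by lra.
    apply Rabs_def2 in E1; apply Rabs_def2 in E2; apply Rabs_def1; lra. }
  intros x Hx.
  destruct (Req_dec x 0) as [->|Hx0]; [auto|].
  destruct (Req_dec x 1) as [->|Hx1]; [auto|].
  split; [apply HYin|apply HPin]; lra.
Qed.

(** * Majorants of solutions *)

Lemma is_derive_of_continuous_slope Y P t :
  (forall z, Rabs (Y z - Y t - P t * (z - t)) <= Rabs (z - t) * Rabs (P z - P t)) ->
  continuous P t -> is_derive Y t (P t).
Proof.
  intros H HP; apply is_derive_Reals; intros e He.
  apply continuity_pt_filterlim in HP; destruct (HP e He) as [r [Hr Hc]].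
  exists (mkposreal r Hr); simpl; intros h Hh0 Hh.
  specialize (H (t + h)); replace (t + h - t) with h in H by ring.
  assert (Hp := Rabs_pos_lt _ Hh0).
  replace ((Y (t + h) - Y t) / h - P t) with ((Y (t + h) - Y t - P t * h) / h)
    by (field; auto).
  unfold Rdiv; rewrite Rabs_mult, Rabs_inv.
  apply Rle_lt_trans with (Rabs (P (t + h) - P t)).
  - apply Rmult_le_reg_r with (Rabs h); auto.
    rewrite Rmult_assoc, Rinv_l by lra; lra.
  - apply Hc; split; [split; [exact I|lra]|].
    simpl; unfold R_dist; replace (t + h - t) with h by ring; auto.
Qed.

(* The majorant is [Y x = x + int_0^x (x - t) |V t| |y t| dt], with slope
   [P = 1 + int_0^x |V| |y|]; both are extended past [0, 1] by clamping the integrals. *)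
Lemma solution_majorant V y A :
  L1_norm_le V A -> is_yV V y ->
  exists F P Y, subsolution F P Y /\ F 1 <= A /\
    primitive_on (fun t => Rabs (V t) * Rabs (y t)) 0 1 P /\
    (forall x, 0 <= x <= 1 ->
       HK_integral (fun t => (x - t) * (Rabs (V t) * Rabs (y t))) 0 x (Y x - x)) /\
    (forall x, 0 <= x <= 1 -> Rabs (y x) <= Y x).
Proof.
  intros [_ [J [HJ HJA]]] [Hyc Hy].
  assert (Hc1 : continuous_within (fun t => Rabs (y t)) 0 1).
  { intros x Hx e He; destruct (Hyc x Hx e He) as [r [Hr H]]; exists r; split; auto.
    intros z Hz1 Hz2; eapply Rle_lt_trans; [apply Rabs_triang_inv2|auto]. }
  (* The kernel x - t is split into x times one integral minus an integral with the extra factor t,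
     so that neither integrand depends on x. *)
  assert (Hc2 : continuous_within (fun t => t * Rabs (y t)) 0 1).
  { intros x Hx e He.
    assert (Hyx := Rabs_pos (y x)).
    destruct (Hc1 x Hx (e / 2)) as [r [Hr H]]; [lra|].
    exists (Rmin r (e / (2 * (Rabs (y x) + 1)))); split.
    { apply Rmin_pos; auto; apply Rdiv_lt_0_compat; lra. }
    intros z Hz1 Hz2.
    assert (M1 := Rmin_l r (e / (2 * (Rabs (y x) + 1)))).
    assert (M2 := Rmin_r r (e / (2 * (Rabs (y x) + 1)))).
    specialize (H z Hz1 ltac:(lra)).
    replace (_ - _) with (z * (Rabs (y z) - Rabs (y x)) + (z - x) * Rabs (y x)) by ring.
    eapply Rle_lt_trans; [apply Rabs_triang|]; rewrite !Rabs_mult, Rabs_Rabsolu.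
    rewrite (Rabs_right z) by lra.
    assert (H0 := Rabs_pos (Rabs (y z) - Rabs (y x))).
    assert (H1 : Rabs (z - x) * Rabs (y x) <= e / 2).
    { apply Rle_trans with (e / (2 * (Rabs (y x) + 1)) * (Rabs (y x) + 1)).
      - apply Rmult_le_compat; try lra; apply Rabs_pos.
      - right; field; lra. }
    nra. }
  assert (HVpos : forall x, 0 <= x <= 1 -> 0 <= Rabs (V x)) by (intros; apply Rabs_pos).
  destruct (HK_primitive _ 0 1 J ltac:(lra) HJ) as [F [HF0 HF]].
  destruct (HK_mult_continuous _ _ 0 1 J ltac:(lra) HJ HVpos Hc1) as [J1 HJ1].
  destruct (HK_mult_continuous _ _ 0 1 J ltac:(lra) HJ HVpos Hc2) as [J2 HJ2].
  destruct (HK_primitive _ 0 1 J1 ltac:(lra) HJ1) as [Q1 [HQ10 HQ1]].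
  destruct (HK_primitive _ 0 1 J2 ltac:(lra) HJ2) as [Q2 [HQ20 HQ2]].
  assert (Hq : forall t, 0 <= Rabs (V t) * Rabs (y t))
    by (intros; apply Rmult_le_pos; apply Rabs_pos).
  assert (HF1 : F 1 = J).
  { apply (HK_unique (fun x => Rabs (V x)) 0 1); auto; [lra|].
    replace (F 1) with (F 1 - F 0) by lra; apply HF; lra. }
  assert (I0 : forall c d, 0 <= c -> c <= d -> d <= 1 -> F c <= F d).
  { intros c d H1 H2 H3; assert (0 <= F d - F c); [|lra].
    apply (HK_nonneg (fun x => Rabs (V x)) c d); auto; intros; apply Rabs_pos. }
  assert (I1 : forall c d, 0 <= c -> c <= d -> d <= 1 -> 0 <= Q1 d - Q1 c).
  { intros c d H1 H2 H3; eapply HK_nonneg; [exact H2|apply HQ1; auto|intros; apply Hq]. }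
  assert (I2 : forall c d, 0 <= c -> c <= d -> d <= 1 ->
            c * (Q1 d - Q1 c) <= Q2 d - Q2 c <= d * (Q1 d - Q1 c)).
  { intros c d H1 H2 H3.
    assert (K1 := HQ1 c d H1 H2 H3); assert (K2 := HQ2 c d H1 H2 H3).
    split.
    - assert (0 <= 1 * (Q2 d - Q2 c) + (- c) * (Q1 d - Q1 c)); [|lra].
      eapply HK_nonneg; [exact H2|apply HK_lin; [exact K2|exact K1]|].
      intros x Hx; specialize (Hq x); simpl; nra.
    - assert (0 <= (-1) * (Q2 d - Q2 c) + d * (Q1 d - Q1 c)); [|lra].
      eapply HK_nonneg; [exact H2|apply HK_lin; [exact K2|exact K1]|].
      intros x Hx; specialize (Hq x); simpl; nra. }
  set (cl := clamp 0 1).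
  assert (Hcl : forall x, 0 <= x <= 1 -> cl x = x).
  { intros x Hx; destruct (clamp_cases 0 1 x) as [[? H]|[[? H]|[? H]]];
      try lra; unfold cl; rewrite H; lra. }
  set (P := fun x => 1 + Q1 (cl x)).
  set (Y := fun x => x + x * Q1 (cl x) - Q2 (cl x)).
  assert (HPQ : forall x, 0 <= x <= 1 -> P x = 1 + Q1 x)
    by (intros x Hx; unfold P; rewrite Hcl; auto).
  assert (HYQ : forall x, 0 <= x <= 1 -> Y x = x + x * Q1 x - Q2 x)
    by (intros x Hx; unfold Y; rewrite Hcl; auto).
  assert (HPc : forall x, 0 <= x <= 1 -> continuous P x).
  { intros t Ht; apply continuity_pt_filterlim; intros e He.
    destruct (primitive_local _ 0 1 Q1 t (e / 2) HQ1 Ht ltac:(lra)) as [r [Hr H]].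
    exists r; split; auto; intros z [_ Hz]; simpl in *; unfold R_dist in *.
    assert (Hz' : Rabs (cl z - t) <= Rabs (z - t)).
    { rewrite <- (Hcl t Ht) at 1; apply clamp_lipschitz; lra. }
    assert (Hz01 : 0 <= cl z <= 1).
    { unfold cl; destruct (clamp_cases 0 1 z) as [[? H']|[[? H']|[? H']]];
        rewrite ?H'; lra. }
    unfold P; rewrite (Hcl t Ht).
    replace (1 + Q1 (cl z) - (1 + Q1 t)) with (Q1 (cl z) - Q1 t) by ring.
    assert (Hlt : Rabs (cl z - t) < r) by lra; apply Rabs_def2 in Hlt.
    destruct (Rle_dec (cl z) t).
    - rewrite Rabs_minus_sym; apply Rle_lt_trans with (e / 2); [|lra]; apply H; lra.
    - apply Rle_lt_trans with (e / 2); [|lra]; apply H; lra. }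
  (* Stated for all reals because the two-sided derivative of [Y] at 0 and 1 looks outside [0, 1],
     where the clamped integrals are constant. *)
  assert (Hinc : forall u v, u <= v ->
            0 <= Q1 (cl v) - Q1 (cl u) /\
            u * (Q1 (cl v) - Q1 (cl u)) <= Q2 (cl v) - Q2 (cl u)
              <= v * (Q1 (cl v) - Q1 (cl u))).
  { intros u v Huv; unfold cl.
    destruct (clamp_cases 0 1 u) as [[? ->]|[[? ->]|[? ->]]]; try lra;
      destruct (clamp_cases 0 1 v) as [[? ->]|[[? ->]|[? ->]]]; try lra;
      try (rewrite !Rminus_diag; lra).
    - assert (K1 := I1 0 v ltac:(lra) ltac:(lra) ltac:(lra)).
      assert (K2 := I2 0 v ltac:(lra) ltac:(lra) ltac:(lra)); nra.
    - assert (K1 := I1 0 1 ltac:(lra) ltac:(lra) ltac:(lra)).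
      assert (K2 := I2 0 1 ltac:(lra) ltac:(lra) ltac:(lra)); nra.
    - assert (K1 := I1 u 0 ltac:(lra) ltac:(lra) ltac:(lra)).
      assert (K2 := I2 u 0 ltac:(lra) ltac:(lra) ltac:(lra)); nra.
    - assert (K1 := I1 u v ltac:(lra) ltac:(lra) ltac:(lra)).
      assert (K2 := I2 u v ltac:(lra) ltac:(lra) ltac:(lra)); nra.
    - assert (K1 := I1 u 1 ltac:(lra) ltac:(lra) ltac:(lra)).
      assert (K2 := I2 u 1 ltac:(lra) ltac:(lra) ltac:(lra)); nra.
    - assert (K1 := I1 1 v ltac:(lra) ltac:(lra) ltac:(lra)).
      assert (K2 := I2 1 v ltac:(lra) ltac:(lra) ltac:(lra)); nra. }
  assert (HYint : forall x, 0 <= x <= 1 ->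
       HK_integral (fun t => (x - t) * (Rabs (V t) * Rabs (y t))) 0 x (Y x - x)).
  { intros x Hx; rewrite HYQ by auto.
    replace (x + x * Q1 x - Q2 x - x) with (x * (Q1 x - Q1 0) + (-1) * (Q2 x - Q2 0))
      by (rewrite HQ10, HQ20; ring).
    eapply HK_ext; [|apply HK_lin; [apply HQ1|apply HQ2]; lra].
    intros t Ht; simpl; ring. }
  assert (HYy : forall x, 0 <= x <= 1 -> Rabs (y x) <= Y x).
  { intros x Hx.
    assert (K1 := HYint x Hx); assert (K2 := Hy x Hx).
    assert (Hsign : forall t, Rabs (V t * y t) = Rabs (V t) * Rabs (y t))
      by (intros; apply Rabs_mult).
    apply Rabs_le; split.
    - assert (0 <= 1 * (Y x - x) + 1 * (y x - x)).
      { eapply HK_nonneg; [apply (proj1 Hx)|apply HK_lin; [exact K1|exact K2]|].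
        intros t Ht; simpl.
        assert (H := Rle_abs (- (V t * y t))); rewrite Rabs_Ropp, Hsign in H; nra. }
      lra.
    - assert (0 <= 1 * (Y x - x) + (-1) * (y x - x)).
      { eapply HK_nonneg; [apply (proj1 Hx)|apply HK_lin; [exact K1|exact K2]|].
        intros t Ht; simpl.
        assert (H := Rle_abs (V t * y t)); rewrite Hsign in H; nra. }
      lra. }
  assert (HYb : forall x, 0 <= x <= 1 -> x <= Y x <= x * P x).
  { intros x Hx; rewrite HYQ, HPQ by auto.
    assert (K := I2 0 x ltac:(lra) ltac:(lra) ltac:(lra)).
    rewrite HQ10, HQ20 in K; lra. }
  exists F, P, Y; split; [split|split; [lra|split; [|split]]]; auto.
  - intros t Ht; apply is_derive_of_continuous_slope; auto.
    intros z; destruct (Rle_dec t z) as [Htz|Htz].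
    + assert (K := Hinc t z Htz).
      unfold P, Y; rewrite (Rabs_right (z - t)) by lra.
      replace (1 + Q1 (cl z) - (1 + Q1 (cl t))) with (Q1 (cl z) - Q1 (cl t)) by ring.
      rewrite (Rabs_right (Q1 (cl z) - Q1 (cl t))) by lra.
      apply Rabs_le; lra.
    + assert (K := Hinc z t ltac:(lra)).
      unfold P, Y; rewrite (Rabs_left (z - t)) by lra.
      replace (1 + Q1 (cl z) - (1 + Q1 (cl t))) with (- (Q1 (cl t) - Q1 (cl z))) by ring.
      rewrite Rabs_Ropp, (Rabs_right (Q1 (cl t) - Q1 (cl z))) by lra.
      apply Rabs_le; lra.
  - rewrite HPQ, HQ10 by lra; ring.
  - intros c d H1 H2 H3; rewrite !HPQ by lra.
    assert (K := I1 c d H1 H2 H3); lra.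
  - intros c d H1 H2 H3; rewrite !HPQ by lra.
    replace (1 + Q1 d - (1 + Q1 c)) with (Q1 d - Q1 c) by ring.
    replace (Y d * (F d - F c)) with (Y d * (F d - F c) + 0 * (F d - F c)) by ring.
    eapply HK_le; [exact H2|apply HQ1; auto|apply HK_lin; apply HF; auto|].
    intros t Ht; simpl.
    (* [Y] dominates |y| and is nondecreasing; this is where W <= |V| comes from. *)
    assert (HYt : Rabs (y t) <= Y d).
    { apply Rle_trans with (Y t); [apply HYy; lra|].
      rewrite !HYQ by lra.
      assert (K1 := I1 t d ltac:(lra) ltac:(lra) ltac:(lra)).
      assert (K2 := I2 t d ltac:(lra) ltac:(lra) ltac:(lra)).
      assert (K3 := I1 0 t ltac:(lra) ltac:(lra) ltac:(lra)).
      rewrite HQ10 in K3; nra. }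
    assert (HVt := Rabs_pos (V t)); nra.
  - intros c d H1 H2 H3; rewrite !HPQ by lra.
    replace (1 + Q1 d - (1 + Q1 c)) with (Q1 d - Q1 c) by ring; auto.
Qed.

(** * Attainment and the case of equality *)

(** For the zero primitive, the Saks-Henstock sum is the Riemann sum of |f|. *)
Lemma HK_abs_of_zero_primitive f a b :
  a <= b -> primitive_on f a b (fun _ => 0) -> HK_integral (fun x => Rabs (f x)) a b 0.
Proof.
  intros Hab Hf; apply HK_integral_of_within; intros r Hr.
  destruct (saks_henstock f a b (fun _ => 0) r) as [d [Hd H]]; auto.
  exists d; split; auto; intros l Hl; specialize (H l Hl).
  rewrite Rminus_0_r, Rabs_right.
  2:{ apply Rle_ge, (riemann_sum_nonneg _ a b); [apply Hl|intros; apply Rabs_pos]. }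
  eapply Rle_trans; [|exact H]; right.
  destruct Hl as [Hl _]; clear - Hl; induction Hl as [|a t b c l Hab Ht Hl IH]; simpl; auto.
  rewrite IH, Rminus_diag, Rminus_0_r, Rabs_mult, (Rabs_right (b - a)) by lra; auto.
Qed.

Lemma null_set_subset (N M : R -> Prop) :
  (forall x, N x -> M x) -> null_set M -> null_set N.
Proof.
  intros H HM e He; destruct (HM e He) as [a [b [H1 [H2 H3]]]].
  exists a, b; split; [|split]; auto.
Qed.

Lemma pot_opt_nonneg k x : 0 <= pot_opt k x.
Proof.
  unfold pot_opt, indicator; assert (H := pow2_ge_0 k).
  repeat destruct Rle_dec; lra.
Qed.

Lemma pulse_clamp_continuous k x : 2 < k -> continuous (pulse_clamp k) x.
Proof.
  intros Hk; apply (continuous_of_lipschitz _ _ 1); intros z; rewrite Rmult_1_l.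
  apply clamp_lipschitz; assert (Hi := inv_le_half k Hk); lra.
Qed.

Lemma pot_opt_integral k : 2 < k -> HK_integral (pot_opt k) 0 1 (k ^ 2 - 2 * k).
Proof.
  intros Hk; assert (Hi := inv_le_half k Hk).
  replace (k ^ 2 - 2 * k) with (k ^ 2 * pulse_clamp k 1 - k ^ 2 * pulse_clamp k 0).
  2:{ destruct (pulse_clamp_cases k 1 Hk) as [[? ->]|[[? ?]|[? ->]]]; try lra.
      destruct (pulse_clamp_cases k 0 Hk) as [[? ->]|[[? ?]|[? ?]]]; try lra.
      field; lra. }
  apply (HK_FTC_except2 (fun x => k ^ 2 * pulse_clamp k x) _ _ _ (1 / k) (1 - 1 / k)).
  - lra.
  - intros t _ H1 H2; unfold pot_opt.
    apply is_derive_scal, pulse_clamp_derive; auto.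
  - intros t _; apply (continuous_scal_r (k ^ 2) (pulse_clamp k)).
    apply pulse_clamp_continuous; auto.
Qed.

Lemma sol_opt_is_yV k : 2 < k -> is_yV (pot_opt k) (sol_opt k).
Proof.
  intros Hk; assert (Hi := inv_le_half k Hk).
  assert (Hcont : forall x, continuous (sol_opt k) x).
  { intros x; apply (ex_derive_continuous (sol_opt k)).
    eexists; apply sol_opt_derive; auto. }
  split.
  - intros x _ e He.
    assert (Hc := Hcont x); apply continuity_pt_filterlim in Hc.
    destruct (Hc e He) as [r [Hr H]]; exists r; split; auto.
    intros z _ Hz; destruct (Req_dec z x) as [->|Hne].
    + rewrite Rminus_diag, Rabs_R0; auto.
    + apply H; split; [split; [exact I|auto]|exact Hz].
  - intros x Hx.
    (* In the derivative of (x - t) y' + y the two terms in y' cancel and (x - t) y'' = (x - t) V y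
       remains. *)
    set (W := fun t => (x - t) * slope_opt k t + sol_opt k t).
    assert (HW : sol_opt k x - x = W x - W 0).
    { unfold W; rewrite (sol_opt_left k 0) by lra.
      replace (slope_opt k 0) with 1; [ring|].
      unfold slope_opt; destruct (pulse_clamp_cases k 0 Hk) as [[? ->]|[[? ?]|[? ?]]];
        try lra.
      rewrite Rminus_diag, Rmult_0_r, exp_0; auto. }
    rewrite HW.
    apply (HK_FTC_except2 W _ _ _ (1 / k) (1 - 1 / k)); [lra| |].
    + intros t _ H1 H2.
      assert (D1 := slope_opt_derive k t Hk H1 H2).
      assert (D2 := sol_opt_derive k t Hk).
      unfold W; auto_derive.
      { repeat split; eexists; eauto. }
      replace (Derive (fun x0 : R => slope_opt k x0) t) with (pot_opt k t * sol_opt k t)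
        by (symmetry; apply is_derive_unique; auto).
      replace (Derive (fun x0 : R => sol_opt k x0) t) with (slope_opt k t)
        by (symmetry; apply is_derive_unique; auto).
      ring.
    + intros t _; unfold W.
      apply (continuous_plus (fun t => (x - t) * slope_opt k t) (sol_opt k)); auto.
      apply (continuous_mult (fun t => x - t) (slope_opt k)).
      * apply (ex_derive_continuous (fun t => x - t)); auto_derive; auto.
      * apply slope_opt_continuous; auto.
Qed.

Lemma solution_opt_unique k V y :
  2 < k -> L1_norm_le V (k ^ 2 - 2 * k) -> is_yV V y -> y 1 = sol_opt k 1 ->
  ae_eq_01 V (pot_opt k).
Proof.
  intros Hk HV Hy Hy1; assert (Hi := inv_le_half k Hk).
  destruct (solution_majorant V y _ HV Hy) as [F [P [Y [HS [HF1 [HP [HYint HYy]]]]]]].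
  assert (HY1 : Y 1 = sol_opt k 1).
  { apply Rle_antisym; [apply (subsolution_bound k F P); auto|].
    rewrite <- Hy1; eapply Rle_trans; [apply Rle_abs|apply HYy; lra]. }
  assert (Hrig := subsolution_rigid k F P Y Hk HS HF1 HY1).
  destruct Hy as [_ Hy].
  (* A nonnegative function whose integral is Y 1 - y 1 = 0: it detects the sign of V. *)
  set (f1 := fun t => (1 - t) * (Rabs (V t) * Rabs (y t) - V t * y t)).
  assert (Hgap : forall t, 0 <= Rabs (V t) * Rabs (y t) - V t * y t).
  { intros t; rewrite <- Rabs_mult; assert (H := Rle_abs (V t * y t)); lra. }
  assert (Hf1 : HK_integral f1 0 1 0).
  { replace 0 with (1 * (Y 1 - 1) + (-1) * (y 1 - 1)) at 2 by (rewrite HY1, Hy1; ring).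
    eapply HK_ext; [|apply HK_lin; [apply HYint|apply Hy]; lra].
    intros t _; unfold f1; simpl; ring. }
  assert (Hf1pos : forall t, 0 <= t <= 1 -> 0 <= f1 t).
  { intros t Ht; apply Rmult_le_pos; [lra|auto]. }
  assert (HyY : forall x, 0 <= x <= 1 -> y x = sol_opt k x).
  { intros x Hx; rewrite <- (proj1 (Hrig x Hx)); apply Rle_antisym.
    { eapply Rle_trans; [apply Rle_abs|apply HYy; auto]. }
    destruct (HK_primitive f1 0 1 0 ltac:(lra) Hf1) as [G [HG0 HG]].
    assert (HG1 : G 1 - G 0 = 0)
      by (apply (HK_unique f1 0 1); auto; [lra|apply HG; lra]).
    (* The deficit Y x - y x has kernel x - t <= 1 - t, so it is at most the integral of [f1] over
       [0, x], which is at most 0. *)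
    assert (HGx : 0 <= G 1 - G x).
    { apply (HK_nonneg f1 x 1); [lra|apply HG; lra|intros; apply Hf1pos; lra]. }
    assert (Hle : 1 * (Y x - x) + (-1) * (y x - x) <= G x - G 0); [|lra].
    eapply HK_le; [apply (proj1 Hx)|apply HK_lin; [apply HYint; auto|apply Hy; auto]
      |apply HG; lra|].
    intros t Ht; unfold f1; simpl; specialize (Hgap t); nra. }
  set (f2 := fun t => (Rabs (V t) - pot_opt k t) * sol_opt k t).
  assert (Hf2 : HK_integral (fun t => Rabs (f2 t)) 0 1 0).
  { apply HK_abs_of_zero_primitive; [lra|]; intros c d H1 H2 H3.
    assert (K1 := HP c d H1 H2 H3).
    rewrite (proj2 (Hrig c ltac:(lra))), (proj2 (Hrig d ltac:(lra))) in K1.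
    assert (K2 : HK_integral (fun t => pot_opt k t * sol_opt k t) c d
                   (slope_opt k d - slope_opt k c)).
    { apply (HK_FTC_except2 (slope_opt k) _ _ _ (1 / k) (1 - 1 / k)); auto.
      - intros; apply slope_opt_derive; auto.
      - intros; apply slope_opt_continuous; auto. }
    replace (0 - 0) with (1 * (slope_opt k d - slope_opt k c) +
                          (-1) * (slope_opt k d - slope_opt k c)) by ring.
    eapply HK_ext; [|apply HK_lin; [exact K1|exact K2]].
    intros t Ht; unfold f2; simpl.
    assert (Hsol : 0 <= sol_opt k t).
    { rewrite <- (proj1 (Hrig t ltac:(lra))).
      assert (H := sub_bounds _ _ _ HS t ltac:(lra)); lra. }
    rewrite (HyY t) by lra; rewrite (Rabs_right (sol_opt k t)) by lra; ring. }
  set (f3 := charf (fun t => t = 0 \/ t = 1)).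
  assert (Hf3 : HK_integral f3 0 1 0).
  { rewrite <- (Rminus_diag 0) at 2.
    apply (HK_FTC_except2 (fun _ => 0) f3 0 1 0 1); [lra| |].
    - intros t _ H0 H1; unfold f3, charf; destruct excluded_middle_informative; [tauto|].
      auto_derive; auto.
    - intros; apply continuous_const. }
  (* [f1] degenerates at 1 and [f2] at 0, so [f3] marks the end points; summing lets one application
     of [null_set_support] treat all three. *)
  set (f := fun t => 1 * (1 * f1 t + 1 * Rabs (f2 t)) + 1 * f3 t).
  assert (Hfpos : forall t, 0 <= t <= 1 -> 0 <= f1 t /\ 0 <= Rabs (f2 t) /\ 0 <= f3 t).
  { intros t Ht; split; [auto|]; split; [apply Rabs_pos|apply charf_bounds]. }
  assert (Hf : HK_integral (fun t => Rabs (f t)) 0 1 0).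
  { apply (HK_ext f).
    { intros t Ht; specialize (Hfpos t Ht); symmetry; apply Rabs_right; unfold f; lra. }
    replace 0 with (1 * (1 * 0 + 1 * 0) + 1 * 0) at 2 by ring.
    apply HK_lin; auto; apply HK_lin; auto. }
  eapply null_set_subset; [|apply (null_set_support f Hf)].
  intros x [Hx HVx]; split; auto; intros Hfx; apply HVx; clear HVx.
  specialize (Hfpos x Hx); unfold f in Hfx.
  assert (E1 : f1 x = 0) by lra; assert (E2 : Rabs (f2 x) = 0) by lra.
  assert (E3 : f3 x = 0) by lra.
  unfold f3, charf in E3; destruct excluded_middle_informative as [|Hne]; [lra|].
  assert (Hx' : 0 < x < 1).
  { split; apply Rnot_le_lt; intros Hle; apply Hne; [left|right]; lra. }
  assert (Hsol := sol_opt_pos k x Hk (proj1 Hx')).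
  unfold f1 in E1; rewrite (HyY x Hx), (Rabs_right (sol_opt k x)) in E1 by lra.
  assert (EV : Rabs (V x) = V x).
  { apply Rmult_eq_reg_r with ((1 - x) * sol_opt k x); [lra|].
    apply Rgt_not_eq, Rmult_lt_0_compat; lra. }
  destruct (Req_dec (f2 x) 0) as [E|E]; [|apply Rabs_no_R0 in E; tauto].
  unfold f2 in E; rewrite EV in E.
  apply Rmult_integral in E; destruct E; lra.
Qed.

Theorem theoremA (A : R) (hA : 0 < A) :
  L1_norm_le (pulse A) A /\
  (exists y, is_yV (pulse A) y /\ det_T y = max_value A) /\
  (forall V y, L1_norm_le V A -> is_yV V y -> det_T y <= max_value A) /\
  (forall V y, L1_norm_le V A -> is_yV V y -> det_T y = max_value A ->
     ae_eq_01 V (pulse A)).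
Proof.
  set (k := 1 + sqrt (1 + A)).
  assert (Hs : sqrt (1 + A) * sqrt (1 + A) = 1 + A) by (apply sqrt_sqrt; lra).
  assert (Hs1 : 1 < sqrt (1 + A)).
  { rewrite <- sqrt_1 at 1; apply sqrt_lt_1; lra. }
  assert (Hk : 2 < k) by (unfold k; lra).
  (* This substitution removes the square root: [ell A] becomes 1 - 2/k and the height A / [ell A]
     becomes k^2. *)
  assert (HA : A = k ^ 2 - 2 * k) by (unfold k; nra).
  assert (Hell : ell A = 1 - 2 / k).
  { unfold ell; fold k; rewrite HA; field; lra. }
  assert (Hlo : 1 / 2 - ell A / 2 = 1 / k) by (rewrite Hell; field; lra).
  assert (Hhi : 1 / 2 + ell A / 2 = 1 - 1 / k) by (rewrite Hell; field; lra).
  assert (Hpot : forall x, pulse A x = pot_opt k x).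
  { intros x; unfold pulse, pot_opt; rewrite Hlo, Hhi; f_equal.
    rewrite Hell, HA; field; lra. }
  assert (Hmax : max_value A = 2 * sol_opt k 1).
  { unfold max_value; fold k; rewrite sol_opt_1 by auto.
    replace (A / k) with (k - 2) by (rewrite HA; field; lra); field; lra. }
  assert (Hint : HK_integral (pulse A) 0 1 A).
  { apply (HK_ext (pot_opt k)); [intros; symmetry; auto|].
    rewrite HA; apply pot_opt_integral; auto. }
  split; [|split; [|split]].
  - split; [exists A; auto|].
    exists A; split; [|lra].
    apply (HK_ext (pulse A)); auto; intros x _; rewrite Hpot, Rabs_right; auto.
    apply Rle_ge, pot_opt_nonneg.
  - exists (sol_opt k); split; [|unfold det_T; auto].
    destruct (sol_opt_is_yV k Hk) as [Hc Hi]; split; auto.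
    intros x Hx; eapply HK_ext; [|apply Hi; auto].
    intros t _; simpl; rewrite Hpot; auto.
  - intros V y HV Hy; rewrite Hmax; unfold det_T.
    destruct (solution_majorant V y A HV Hy) as [F [P [Y [HS [HF1 [_ [_ HYy]]]]]]].
    assert (Hb := subsolution_bound k F P Y Hk HS ltac:(lra)).
    assert (H1 := HYy 1 ltac:(lra)); assert (H2 := Rle_abs (y 1)); lra.
  - intros V y HV Hy Heq; rewrite Hmax in Heq; unfold det_T in Heq.
    rewrite HA in HV.
    eapply null_set_subset; [|apply (solution_opt_unique k V y); auto; lra].
    intros x [Hx Hne]; rewrite Hpot in Hne; auto.
Qed.
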